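(* Let $\{w_i\}_{i=1}^n$ be a basis of $\mathbb{R}^n$ and let $(S_1,\dots,S_m)$ form a uniform cover of $[n]$ with weights $(p_1,\dots,p_m)$. Let $H_j=\mathrm{span}\{w_k : k\in S_j\}$, $\widetilde{H}_j=\mathrm{span}\{w_k : k\notin S_j\}$ and $p=\sum_{j=1}^m p_j$. Put $$BL_1:=\frac{\prod_{j=1}^m|\wedge_{k\in[n]\setminus S_j}w_k|^{p_j}}{|\wedge_{i=1}^n w_i|^{p-1}},\qquad BL_2:=\frac{\prod_{j=1}^m|\wedge_{k\in S_j}w_k|^{p_j}}{|\wedge_{i=1}^n w_i|}.$$ Then for every $f:\mathbb{R}^n\to\mathbb{R}$ with compact support and continuous on its support the following four inequalities hold: $$\Vert f\Vert_p\leqslant BL_1^{1/p}\prod_{j=1}^m\Vert P_{\widetilde{H}_j^\perp}|f|\Vert_1^{p_j/p},\qquad \Vert f\Vert_{\frac{p}{p-1}}\leqslant BL_2^{1/p}\prod_{j=1}^m\Vert P_{H_j^\perp}|f|\Vert_1^{p_j/p},$$ $$\Vert f\Vert_p\leqslant BL_2^{1/p}\prod_{j=1}^m\Vert P_{H_j}|f|\Vert_1^{p_j/p},\qquad \Vert f\Vert_{\frac{p}{p-1}}\leqslant BL_1^{1/p}\prod_{j=1}^m\Vert P_{\widetilde{H}_j}|f|\Vert_1^{p_j/p}.$$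
   Context: $[n]=\{1,\dots,n\}$. For $m\geqslant1$, subsets $S_1,\dots,S_m\subseteq[n]$ (not necessarily distinct) form a uniform cover of $[n]$ with weights $(p_1,\dots,p_m)$, $p_j>0$ for all $j$, if $\sum_{j=1}^m p_j\chi_{S_j}(i)=1$ for every $i\in[n]$ (so $p\geqslant1$; if $p=1$, $p/(p-1)$ is read as $\infty$). For vectors $u_1,\dots,u_k$, $|\wedge_{i=1}^k u_i|$ is the $k$-dimensional volume of the parallelepiped they span (equal to $1$ for the empty family). For $g:\mathbb{R}^n\to\mathbb{R}$ and a linear subspace $F$ of $\mathbb{R}^n$ with orthogonal complement $F^\perp$, the projection of $g$ onto $F$ is the function on $F$ given by $P_Fg(x)=\sup_{y\in F^\perp}g(x+y)$, $x\in F$. $\Vert\cdot\Vert_q$ is the usual $L^q$ norm on $\mathbb{R}^n$, and $\Vert P_Fg\Vert_1$ is the $L^1$ norm with respect to Lebesgue measure on $F$ (unit point mass on $\{0\}$); $\Vert\cdot\Vert_\infty$ denotes the supremum of the absolute value. *)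

(* Defs.v *)
From HB Require Import structures.
From mathcomp Require Import all_boot all_order all_algebra.
From mathcomp Require Import all_classical all_reals all_analysis.
Import Order.TTheory GRing.Theory Num.Theory.
Import numFieldNormedType.Exports.

Set Implicit Arguments.
Unset Strict Implicit.
Unset Printing Implicit Defensive.

Local Open Scope classical_set_scope.
Local Open Scope ring_scope.

(* R^n is 'rV[R]_n for the linear algebra and the topology; measures live on
   n.-tuple (measurableTypeR R), which carries the product sigma-algebra.
   Linear subspaces of R^n are row spaces of matrices 'M[R]_n. *)

Section lebesgue_tuple.
Context (R : realType).
Local Notation mR := (measurableTypeR R).

Definition tuple_cons n (x : mR * n.-tuple mR) : n.+1.-tuple mR :=
  [tuple of x.1 :: x.2].

Lemma measurable_tuple_cons n : measurable_fun [set: mR * n.-tuple mR]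
  (@tuple_cons n).
Proof. exact: measurable_cons. Qed.

Section step.
Context (n : nat) (mu : {sigma_finite_measure set (n.-tuple mR) -> \bar R}).

Definition lebesgue_cons : set (n.+1.-tuple mR) -> \bar R :=
  pushforward ((@lebesgue_measure R) \x mu)%E (@tuple_cons n).

Let lebesgue_cons0 : lebesgue_cons set0 = 0%E.
Proof. by rewrite /lebesgue_cons /pushforward preimage_set0 measure0. Qed.

Let lebesgue_cons_ge0 A : (0 <= lebesgue_cons A)%E.
Proof. by rewrite /lebesgue_cons /pushforward measure_ge0. Qed.

Let lebesgue_cons_sigma_additive : semi_sigma_additive lebesgue_cons.
Proof.
move=> F mF tF mUF; rewrite /lebesgue_cons /pushforward preimage_bigcup.
have mpre A : measurable A -> measurable (@tuple_cons n @^-1` A).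
  by move=> mA; rewrite -[X in measurable X]setTI; exact: measurable_tuple_cons.
apply: measure_semi_sigma_additive => [k||].
- exact: mpre.
- apply/trivIsetP => /= i j _ _ ij; rewrite -preimage_setI.
  by move/trivIsetP : tF => /(_ _ _ _ _ ij) ->//; rewrite preimage_set0.
- by rewrite -preimage_bigcup; exact: mpre.
Qed.

HB.instance Definition _ := isMeasure.Build _ _ _ lebesgue_cons
  lebesgue_cons0 lebesgue_cons_ge0 lebesgue_cons_sigma_additive.

Let sigma_finite_lebesgue_cons : sigma_finite setT lebesgue_cons.
Proof.
have /sigma_finiteP[F [TF ndF Foo]] := sigma_finiteT (@lebesgue_measure R).
have /sigma_finiteP[G [TG ndG Goo]] := sigma_finiteT mu.
pose beheadt (t : n.+1.-tuple mR) : n.-tuple mR := [tuple of behead t].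
have consE A B :
    @tuple_cons n @^-1` ((@thead n mR @^-1` A) `&` (beheadt @^-1` B)) = A `*` B.
  rewrite eqEsubset; split => -[x t]; rewrite /= /thead (tnth_nth x) /=;
    by rewrite (_ : beheadt _ = t)//; exact/val_inj.
exists (fun k => (@thead n mR @^-1` F k) `&` (beheadt @^-1` G k)).
  apply/esym; rewrite -subTset => t _.
  have [i _ Fi] : (\bigcup_i F i) (thead t) by rewrite -TF.
  have [j _ Gj] : (\bigcup_i G i) (beheadt t) by rewrite -TG.
  exists (maxn i j) => //; split.
    by have /subsetPset := ndF _ _ (leq_maxl i j); exact.
  by have /subsetPset := ndG _ _ (leq_maxr i j); exact.
move=> k; have [mF Fk] := Foo k; have [mG Gk] := Goo k; split.
  apply: measurableI; rewrite -[X in measurable X]setTI.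
    exact: measurable_tnth.
  exact: measurable_behead.
rewrite /lebesgue_cons /pushforward consE product_measure1E//.
by rewrite lte_mul_pinfty// ge0_fin_numE.
Qed.

HB.instance Definition _ := Measure_isSigmaFinite.Build _ _ _ lebesgue_cons
  sigma_finite_lebesgue_cons.
End step.

Fixpoint lebesgue_tuple n : {sigma_finite_measure set (n.-tuple mR) -> \bar R} :=
  match n with
  | 0 => dirac [tuple]
  | n'.+1 => lebesgue_cons (lebesgue_tuple n')
  end.
End lebesgue_tuple.

Section euclidean_subspaces.
Context (R : realType) (n : nat).
Local Notation V := 'rV[R]_n.
Implicit Types (F : 'M[R]_n) (g : V -> R).

Lemma orthonormal_basis_free k (A : 'M[R]_(k, n)) : row_free A ->
  exists2 B : 'M[R]_(k, n), B *m B^T = 1%:M & (B :=: A)%MS.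
Proof.
elim: k A => [A _|k IH].
  by exists A => //; rewrite [LHS]flatmx0 [RHS]flatmx0.
rewrite -add1n => A freeA; pose a := usubmx A; pose A' := dsubmx A.
have AE : A = col_mx a A' by rewrite vsubmxK.
have freeA' : row_free A'.
  apply/inj_row_free => v vA'0.
  have /(congr1 rsubmx) : row_mx (0 : 'rV_1) v = 0 :> 'rV_(1 + k).
    by apply: (row_free_inj freeA); rewrite mul0mx AE mul_row_col mul0mx add0r.
  by rewrite row_mxKr linear0.
have [B' B'1 B'E] := IH _ freeA'.
pose v := a - a *m B'^T *m B'.
have vB' : v *m B'^T = 0 by rewrite mulmxBl -(mulmxA _ B') B'1 mulmx1 subrr.
have v0 : v != 0.
  apply/eqP => /eqP; rewrite subr_eq0 => /eqP aE.
  have aA' : (a <= A')%MS by rewrite aE -B'E submxMl.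
  have /submxP[c cE] := aA'.
  have : row_mx (1%:M : 'M[R]_1) (- c) = 0 :> 'rV_(1 + k).
    apply: (row_free_inj freeA); rewrite mul0mx AE mul_row_col mul1mx mulNmx.
    by rewrite -cE subrr.
  move/(congr1 lsubmx); rewrite row_mxKl linear0 => /matrixP/(_ 0 0).
  by rewrite !mxE => /eqP; rewrite oner_eq0.
pose d := (v *m v^T) 0 0.
have dE : d = \sum_i v 0 i ^+ 2.
  by rewrite /d mxE; apply: eq_bigr => i _; rewrite !mxE.
have d0 : 0 < d.
  rewrite lt_def dE sumr_ge0 ?andbT; last by move=> i _; exact: sqr_ge0.
  apply: contraNN v0; rewrite psumr_eq0; last by move=> i _; exact: sqr_ge0.
  move=> /allP v0; apply/eqP/rowP => i; rewrite [RHS]mxE.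
  by have := v0 i (mem_index_enum i); rewrite /= sqrf_eq0 => /eqP.
pose s := (Num.sqrt d)^-1.
have s0 : s != 0 by rewrite invr_eq0 gt_eqF// sqrtr_gt0.
exists (col_mx (s *: v) B').
  rewrite tr_col_mx mul_col_row B'1 (@scalar_mx_block _ 1 k).
  rewrite linearZ/= -!scalemxAl -!scalemxAr vB' scaler0.
  have -> : B' *m v^T = 0 by rewrite -[LHS]trmxK trmx_mul trmxK vB' trmx0.
  rewrite scaler0; congr block_mx.
  rewrite [v *m _]mx11_scalar -/d scalerA -expr2 exprVn sqr_sqrtr ?ltW//.
  by rewrite scale_scalar_mx mulVf// gt_eqF.
have sv_sub : (s *: v <= a + A')%MS.
  rewrite scalemx_sub// addmx_sub ?addsmxSl// -mulNmx.
  by rewrite (submx_trans (submxMl _ _))// B'E addsmxSr.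
have a_sub : (a <= s *: v + B')%MS.
  rewrite -[X in (X <= _)%MS](subrK (a *m B'^T *m B')) -/v addmx_sub//.
    by rewrite -(eqmx_scale v s0) addsmxSl.
  by rewrite (submx_trans (submxMl _ _)) ?addsmxSr.
apply/eqmxP; rewrite AE -!addsmxE !addsmx_sub sv_sub a_sub B'E addsmxSr/=.
by rewrite -B'E addsmxSr.
Qed.

Lemma orthonormal_basis_exists F :
  exists B : 'M[R]_(\rank F, n), B *m B^T = 1%:M /\ (B :=: F)%MS.
Proof.
have [B B1 BE] := orthonormal_basis_free (row_base_free F).
by exists B; split=> //; exact: eqmx_trans BE (eq_row_base F).
Qed.

Definition orthonormal_basis F : 'M[R]_(\rank F, n) :=
  sval (cid (orthonormal_basis_exists F)).

Definition row_of_tuple k (t : k.-tuple (measurableTypeR R)) : 'rV[R]_k :=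
  \row_(i < k) tnth t i.

(* An isometry from R^(dim F) onto F; Lebesgue measure on F is the image of
   Lebesgue measure on R^(dim F) under it. For F = {0} this is the unit point
   mass at 0. *)
Definition isometry_onto F (t : (\rank F).-tuple (measurableTypeR R)) : V :=
  row_of_tuple t *m orthonormal_basis F.

Definition subspace_lebesgue F (A : set V) : \bar R :=
  lebesgue_tuple R (\rank F) (@isometry_onto F @^-1` A).

Definition subspace_norm1 F (h : V -> \bar R) : \bar R :=
  'N[lebesgue_tuple R (\rank F)]_1[h \o @isometry_onto F]%E.

(* The library's 'N[mu]_+oo is the essential supremum, hence the case split. *)
Definition Lq_norm (q : \bar R) g : \bar R :=
  if q is +oo%E then ereal_sup (range (fun x => `|g x|%:E))
  else 'N[lebesgue_tuple R n]_q[EFin \o g \o @row_of_tuple n]%E.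

Definition orthogonal_complement F : 'M[R]_n := orthomx idfun 1%:M F.

Definition projection F g (x : V) : \bar R :=
  ereal_sup [set (g (x + y))%:E |
    y in [set y : V | (y <= orthogonal_complement F)%MS]].

Definition support_set g : set V := closure [set x | g x != 0].

Implicit Types (w : 'I_n -> V) (S : {set 'I_n}).

Definition lin_span w S : 'M[R]_n := (\sum_(k in S) <<w k>>)%MS.

Definition parallelepiped w S : set V :=
  [set x | exists t : 'I_n -> R,
    (forall k, 0 <= t k <= 1) /\ x = \sum_(k in S) t k *: w k].

(* |S|-dimensional volume of the parallelepiped; a linearly dependent family
   spans a subspace of dimension < |S|, so its volume is 0. *)
Definition wedge_norm w S : R :=
  if \rank (lin_span w S) == #|S|
  then fine (subspace_lebesgue (lin_span w S) (parallelepiped w S)) else 0.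
End euclidean_subspaces.

Definition uniform_cover (R : realType) (n m : nat) (S : 'I_m -> {set 'I_n})
    (p : 'I_m -> R) : Prop :=
  [/\ (0 < m)%N, (forall j, 0 < p j) &
      forall i, \sum_(j < m) p j * (i \in S j)%:R = 1].

Section brascamp_lieb_constants.
Context (R : realType) (n m : nat).
Variables (w : 'I_n -> 'rV[R]_n) (S : 'I_m -> {set 'I_n}) (p : 'I_m -> R).

Definition BL1 : R :=
  (\prod_(j < m) wedge_norm w (~: S j)%SET `^ p j) /
  wedge_norm w [set: 'I_n]%SET `^ (\sum_(j < m) p j - 1).

Definition BL2 : R :=
  (\prod_(j < m) wedge_norm w (S j) `^ p j) / wedge_norm w [set: 'I_n]%SET.
End brascamp_lieb_constants.

(* Main.v *)
Require Import Defs.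
From mathcomp Require Import all_boot all_order all_algebra.
From mathcomp Require Import all_classical all_reals all_analysis.
From mathcomp Require Import measurable_realfun.
From mathcomp Require Import ring.
Import Order.TTheory GRing.Theory Num.Theory.
Import numFieldNormedType.Exports.

Set Implicit Arguments.
Unset Strict Implicit.
Unset Printing Implicit Defensive.

Local Open Scope classical_set_scope.
Local Open Scope ring_scope.

(** Let W be an invertible matrix, let F_j be the span of its rows with index in
    S_j, and put y = x W^T. The orthogonal projection of a point x onto F_j is
    determined by the coordinates y_k with k in S_j, and |f|(x) is at most the
    value of P_{F_j}|f| at that projection; so |f| is dominated by functions
    H_j(y), each of which depends on the coordinates in S_j only. As
    |f|^p = prod_j |f|^{p_j}, Finner's inequality [finner] bounds the integral
    of |f|^p by the product of the p_j-th powers of the integrals of the H_j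
    over the coordinates in S_j. Passing from y to x costs the factor
    1/|det W|, and parametrizing F_j by these coordinates costs the volume of
    the parallelepiped spanned by the rows with index in S_j
    [row_integral_fiber]. The result is [Lq_norm_le], from which all four
    inequalities follow.

    - With the w_k as rows of W, it is the third inequality; volumes are square
      roots of Gram determinants [wedge_normE].
    - With the dual basis as rows of W, it is the first inequality: the dual
      vectors with index in S_j span the orthogonal complement of the w_k with
      k outside S_j [orthogonal_span], and Jacobi's identity for complementary
      minors [vol_dual] relates the two volumes.
    - If p > 1, the complements of the S_j with the weights p_j/(p-1) form
      again a uniform cover, of total weight p/(p-1), the exponent conjugate to
      p. Exchanging the covers exchanges the two constants up to the power
      1/(p-1), so the two inequalities above for the complementary cover are
      the fourth and the second one. If p = 1, every S_j is [n], the subspaces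
      in question are trivial, and both sides are the supremum of |f|.

    Finner's inequality is proved by induction on the dimension, by integrating
    one coordinate at a time (Tonelli) and applying Hoelder's inequality for
    several functions [hoelder_prod] to those factors that depend on this
    coordinate. The linear change of variables [row_integral_linear] is
    obtained from elementary matrices. Functions P_F|f| are measurable because
    the sets where they exceed a nonnegative constant are countable unions of
    linear images of compact sets [borel_projection]. *)

(** * Hoelder's inequality for several functions *)

Section hoelder_prod.
Context (R : realType).

(** Weighted arithmetic-geometric mean: with A the weighted mean,
    ln (y_j / A) <= y_j / A - 1, and the weighted sum of the right-hand sides
    vanishes. *)
Lemma amgm_real m (P : pred 'I_m) (p y : 'I_m -> R) :
  (forall j, P j -> 0 <= p j) -> \sum_(j | P j) p j = 1 ->
  (forall j, P j -> 0 < y j) ->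
  \prod_(j | P j) y j `^ p j <= \sum_(j | P j) p j * y j.
Proof.
move=> p0 p1 y0.
set A := leRHS.
have A0 : 0 < A.
  have A0 : 0 <= A by apply: sumr_ge0 => j Pj; rewrite mulr_ge0 ?p0 // ltW ?y0.
  rewrite lt_def A0 andbT; apply/negP => /eqP A00.
  have /eqP := A00; rewrite psumr_eq0; last first.
    by move=> j Pj; rewrite mulr_ge0 ?p0 // ltW ?y0.
  move=> /allP z; suff : \sum_(j | P j) p j = 0 by rewrite p1 => /eqP; rewrite oner_eq0.
  apply: big1 => j Pj; have := z j (mem_index_enum _); rewrite Pj /=.
  by rewrite mulf_eq0 (gt_eqF (y0 _ Pj)) orbF => /eqP.
have -> : \prod_(j | P j) y j `^ p j = expR (\sum_(j | P j) p j * ln (y j)).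
  rewrite expR_sum; apply: eq_bigr => j Pj.
  by rewrite /powR gt_eqF ?y0.
rewrite -[leRHS]lnK ?posrE// ler_expR -subr_le0.
have -> : \sum_(j | P j) p j * ln (y j) - ln A = \sum_(j | P j) p j * ln (y j / A).
  rewrite -[ln A]mul1r -p1 mulr_suml -sumrB; apply: eq_bigr => j Pj.
  by rewrite ln_div ?posrE ?y0// mulrBr.
apply: (@le_trans _ _ (\sum_(j | P j) p j * (y j / A - 1))).
  apply: ler_sum => j Pj; apply: ler_wpM2l; first exact: p0.
  rewrite -[X in _ <= X - 1]lnK ?posrE ?divr_gt0 ?y0//.
  by rewrite lerBrDl expR_ge1Dx.
under eq_bigr do rewrite mulrBr mulr1 mulrA.
by rewrite sumrB p1 -mulr_suml divff ?gt_eqF// subrr.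
Qed.

Local Open Scope ereal_scope.

Lemma prode_ge0 m (P : pred 'I_m) (y : 'I_m -> \bar R) :
  (forall j, P j -> 0 <= y j) -> 0 <= \big[*%E/1]_(j | P j) y j.
Proof. by move=> y0; elim/big_ind: _ => // a b; exact: mule_ge0. Qed.

Lemma prode_eq0 m (P : pred 'I_m) (y : 'I_m -> \bar R) j :
  P j -> y j = 0 -> \big[*%E/1]_(j | P j) y j = 0.
Proof. by move=> Pj y0; rewrite (bigD1 j)//= y0 mul0e. Qed.

Lemma prode_gt0 m (P : pred 'I_m) (y : 'I_m -> \bar R) :
  (forall j, P j -> 0 < y j) -> 0 < \big[*%E/1]_(j | P j) y j.
Proof. by move=> y0; elim/big_ind: _ => // a b; exact: mule_gt0. Qed.

(** The real case extends to infinite values: a zero factor annihilates the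
    left-hand side even if another factor is infinite, and otherwise an infinite
    factor makes the right-hand side infinite. *)
Lemma amgm m (P : pred 'I_m) (p : 'I_m -> R) (y : 'I_m -> \bar R) :
  (forall j, P j -> 0 < p j)%R -> (\sum_(j | P j) p j = 1)%R ->
  (forall j, P j -> 0 <= y j) ->
  \big[*%E/1]_(j | P j) (y j `^ p j) <= \sum_(j | P j) (p j)%:E * y j.
Proof.
move=> p0 p1 y0.
have py0 j : P j -> 0 <= (p j)%:E * y j.
  by move=> Pj; rewrite mule_ge0 ?y0// lee_fin ltW ?p0.
have [/existsP[j /andP[Pj /eqP yj]]|ny0] := boolP [exists j, P j && (y j == 0)].
  rewrite (@prode_eq0 _ _ _ j)//; first exact: sume_ge0.
  by rewrite yj poweR0r// gt_eqF ?p0.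
have [/existsP[j /andP[Pj /eqP yj]]|nyoo] := boolP [exists j, P j && (y j == +oo)].
  rewrite [leRHS](_ : _ = +oo) ?leey//; apply/eqP; rewrite esum_eqy; last first.
    by move=> i Pi; rewrite -ltNye (lt_le_trans _ (py0 _ Pi)).
  by apply/exists_inP; exists j => //; rewrite yj gt0_muley// lte_fin p0.
have yE j : P j -> y j = (fine (y j))%:E.
  move=> Pj; rewrite fineK// ge0_fin_numE ?y0// ltey.
  by move/existsPn : nyoo => /(_ j); rewrite Pj.
have yfin j : P j -> (0 < fine (y j))%R.
  move=> Pj; rewrite -lte_fin -yE// lt_def y0// andbT.
  by move/existsPn : ny0 => /(_ j); rewrite Pj.
rewrite [leLHS](eq_bigr (fun j => ((fine (y j)) `^ p j)%:E)); last first.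
  by move=> j Pj; rewrite -poweR_EFin -yE.
rewrite [leRHS](eq_bigr (fun j => (p j * fine (y j))%:E)); last first.
  by move=> j Pj; rewrite EFinM -yE.
rewrite prodEFin sumEFin lee_fin.
exact: (@amgm_real m P p (fine \o y) (fun j Pj => ltW (p0 j Pj)) p1 yfin).
Qed.

Context d (T : measurableType d) (mu : {measure set T -> \bar R}).

Lemma emeasurable_prod m (P : pred 'I_m) (f : 'I_m -> T -> \bar R) :
  (forall j, P j -> measurable_fun [set: T] (f j)) ->
  measurable_fun [set: T] (fun x => \big[*%E/1]_(j | P j) f j x).
Proof.
move=> mf; under eq_fun do rewrite big_mkcond.
elim: (index_enum _) => [|j s IH]; first by under eq_fun do rewrite big_nil; exact: measurable_cst.
under eq_fun do rewrite big_cons.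
apply: emeasurable_funM => //.
by case: (boolP (P j)) => [/mf//|_]; exact: measurable_cst.
Qed.

Lemma measurable_poweRT (f : T -> \bar R) (r : R) :
  measurable_fun [set: T] f -> measurable_fun setT (fun x => f x `^ r).
Proof. by move=> mf; exact: (measurableT_comp (measurable_poweR _)). Qed.

(** After normalizing every factor to have integral 1, integrate the
    arithmetic-geometric mean inequality pointwise. Integrals equal to 0 or +oo
    cannot be normalized and are treated apart. *)
Lemma hoelder_prod m (P : pred 'I_m) (p : 'I_m -> R) (f : 'I_m -> T -> \bar R) :
  (forall j, P j -> 0 < p j)%R -> (\sum_(j | P j) p j = 1)%R ->
  (forall j, P j -> measurable_fun [set: T] (f j)) ->
  (forall j x, P j -> 0 <= f j x) ->
  \int[mu]_x \big[*%E/1]_(j | P j) (f j x `^ p j) <=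
  \big[*%E/1]_(j | P j) (\int[mu]_x f j x) `^ p j.
Proof.
move=> p0 p1 mf f0.
have I0 j : P j -> 0 <= \int[mu]_x f j x.
  by move=> Pj; apply: integral_ge0 => x _; exact: f0.
have mprod : measurable_fun [set: T] (fun x => \big[*%E/1]_(j | P j) (f j x `^ p j)).
  by apply: emeasurable_prod => j Pj; apply: measurable_poweRT; exact: mf.
have prod0 x : 0 <= \big[*%E/1]_(j | P j) (f j x `^ p j).
  by apply: prode_ge0 => j _; exact: poweR_ge0.
have [/existsP[j /andP[Pj /eqP Ij]]|nI0] :=
    boolP [exists j, P j && (\int[mu]_x f j x == 0)].
  (* this factor vanishes almost everywhere, hence so does the product *)
  rewrite [leLHS](_ : _ = 0); last first.
    rewrite (ge0_ae_eq_integral _ _ _ _ _ (_ : ae_eq mu setT _ (cst 0)))//.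
      by rewrite integral0.
    have := ae_eq_integral_abs mu measurableT (mf _ Pj).
    rewrite (eq_integral (f j)); last by move=> x _; rewrite gee0_abs// f0.
    move=> [/(_ Ij) + _]; apply: filterS => x /= /[apply] fj0.
    by rewrite (prode_eq0 Pj)// fj0 poweR0r// gt_eqF// p0.
  by apply: prode_ge0 => i _; exact: poweR_ge0.
have Igt0 j : P j -> 0 < \int[mu]_x f j x.
  by move=> Pj; rewrite lt_def I0// andbT; move/existsPn: nI0 => /(_ j); rewrite Pj.
have [/existsP[j /andP[Pj /eqP Ij]]|nIoo] :=
    boolP [exists j, P j && (\int[mu]_x f j x == +oo)].
  rewrite (bigD1 j)//= Ij poweRyr ?gt_eqF ?p0// gt0_mulye ?leey//.
  by apply: prode_gt0 => i /andP[Pi _]; rewrite poweR_gt0 ?Igt0.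
pose a j := fine (\int[mu]_x f j x).
have aE j : P j -> \int[mu]_x f j x = (a j)%:E.
  move=> Pj; rewrite fineK// ge0_fin_numE ?I0// ltey.
  by move/existsPn : nIoo => /(_ j); rewrite Pj.
have a0 j : P j -> (0 < a j)%R by move=> Pj; rewrite -lte_fin -aE// Igt0.
pose g j x := (a j)^-1%:E * f j x.
have g0 j x : P j -> 0 <= g j x.
  by move=> Pj; rewrite mule_ge0 ?f0// lee_fin invr_ge0 ltW ?a0.
have mg j : P j -> measurable_fun [set: T] (g j).
  by move=> Pj; apply: emeasurable_funM => //; exact: mf.
have fE j x : P j -> f j x = (a j)%:E * g j x.
  by move=> Pj; rewrite muleA -EFinM divff ?mul1e// gt_eqF ?a0.
have Ig j : P j -> \int[mu]_x g j x = 1.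
  move=> Pj; rewrite ge0_integralZl_EFin ?invr_ge0 ?(ltW (a0 _ Pj))//.
  - by rewrite aE// -EFinM mulVf// gt_eqF ?a0.
  - by move=> x _; exact: f0.
  - exact: mf.
rewrite (eq_integral (fun x => (\prod_(j | P j) a j `^ p j)%:E *
    \big[*%E/1]_(j | P j) (g j x `^ p j))); last first.
  move=> x _; rewrite -prodEFin -big_split/=; apply: eq_bigr => j Pj.
  by rewrite -poweR_EFin -poweRM ?lee_fin ?(ltW (a0 _ Pj)) ?g0// -fE.
have -> : \big[*%E/1]_(j | P j) (\int[mu]_x f j x) `^ p j = (\prod_(j | P j) a j `^ p j)%:E.
  by rewrite -prodEFin; apply: eq_bigr => j Pj; rewrite aE.
have pa0 : (0 <= \prod_(j | P j) a j `^ p j)%R by apply: prodr_ge0 => j _; exact: powR_ge0.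
have mpg : measurable_fun [set: T] (fun x => \big[*%E/1]_(j | P j) (g j x `^ p j)).
  by apply: emeasurable_prod => j Pj; apply: measurable_poweRT; exact: mg.
rewrite ge0_integralZl_EFin//; last first.
  by move=> x _; apply: prode_ge0 => j _; exact: poweR_ge0.
rewrite -[leRHS]mule1; apply: lee_wpmul2l; first by rewrite lee_fin.
apply: (@le_trans _ _ (\int[mu]_x \sum_(j | P j) (p j)%:E * g j x)).
  apply: ge0_le_integral => //.
  - by move=> x _; apply: prode_ge0 => j _; exact: poweR_ge0.
  - under eq_fun do rewrite big_mkcond.
    apply: emeasurable_sum => j.
    case: (boolP (P j)) => [Pj|_]; last exact: measurable_cst.
    by apply: emeasurable_funM => //; exact: mg.
  - by move=> x _; apply: amgm => // j Pj; exact: g0.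
under eq_integral do rewrite big_mkcond.
rewrite ge0_integral_sum//; last 2 first.
- move=> j; case: (boolP (P j)) => [Pj|_]; last exact: measurable_cst.
  by apply: emeasurable_funM => //; exact: mg.
- by move=> j x _; case: (boolP (P j)) => // Pj; rewrite mule_ge0 ?g0// lee_fin ltW ?p0.
rewrite -p1 -sumEFin [leRHS]big_mkcond; apply: lee_sum => j _.
case: (boolP (P j)) => Pj; last by rewrite integral0.
rewrite ge0_integralZl_EFin ?(ltW (p0 _ Pj))//.
- by rewrite Ig// mule1.
- by move=> x _; exact: g0.
- exact: mg.
Qed.
End hoelder_prod.

(** * Affine changes of variable on the line *)

Section affine_line.
Context (R : realType).
Local Notation mR := (measurableTypeR R).
Local Notation mu := (@lebesgue_measure R).

Lemma measurable_affine (a b : R) :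
  measurable_fun [set: mR] ((fun x => a * x + b) : mR -> mR).
Proof. by apply: measurable_funD => //; exact: measurable_funM. Qed.

(** The measure structure on an image measure takes the measurability of the
    map as an argument that inference does not find, hence the named instance. *)
Let affine_measure (a b : R) : {measure set mR -> \bar R} :=
  mscale (NngNum (normr_ge0 a))
   (measure_function_pushforward__canonical__measure_function_Measure mu (measurable_affine a b)).

(** Lebesgue measure is characterized by its values on the intervals ]c, d],
    on which the two sides are computed. *)
Lemma lebesgue_measure_affine (a b : R) (A : set mR) : a != 0 -> measurable A ->
  mu A = affine_measure a b A.
Proof.
move=> a0 mA; apply: lebesgue_measure_unique => // _ [[c d]] _ <-.
rewrite [RHS](_ : _ = `|a|%:E * mu ((fun x => a * x + b)%R @^-1` `]c, d]))%E//.
have [a_gt0|a_le0] := ltP 0 a.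
  rewrite (_ : _ @^-1` _ = `](c - b) / a, (d - b) / a]%classic); last first.
    apply/seteqP; split=> x /=; rewrite !in_itv/=;
    by rewrite ltr_pdivrMr// ler_pdivlMr// ltrBlDr lerBrDr mulrC.
  rewrite !lebesgue_measure_itv/= !lte_fin ltr_pM2r ?invr_gt0// ltrD2r.
  case: ifPn => _; last by rewrite mule0.
  rewrite -!EFinB -EFinM gtr0_norm// -mulrBl mulrCA divff// mulr1; congr EFin.
  ring.
have a_lt0 : a < 0 by rewrite lt_def eq_sym a0.
rewrite (_ : _ @^-1` _ = `[(d - b) / a, (c - b) / a[%classic); last first.
  apply/seteqP; split=> x /=; rewrite !in_itv/=;
  by rewrite ltr_ndivlMr// ler_ndivrMr// ltrBlDr lerBrDr (mulrC x) andbC.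
rewrite !lebesgue_measure_itv/= !lte_fin ltr_nM2r ?invr_lt0// ltrD2r.
case: ifPn => _; last by rewrite mule0.
rewrite -!EFinB -EFinM ltr0_norm// -mulrBl mulNr mulrCA divff// mulr1; congr EFin.
ring.
Qed.

Lemma ge0_integral_affine (a b : R) (f : mR -> \bar R) : a != 0 ->
  measurable_fun [set: mR] f -> (forall x, 0 <= f x)%E ->
  (\int[mu]_x f (a * x + b)%R = `|a|^-1%:E * \int[mu]_x f x)%E.
Proof.
move=> a0 mf f0.
have -> : (\int[mu]_x f x = `|a|%:E * \int[mu]_x f (a * x + b)%R)%E.
  rewrite (eq_measure_integral (affine_measure a b)); last first.
    by move=> A mA _; exact: lebesgue_measure_affine.
  rewrite ge0_integral_mscale//=; congr (_ * _)%E.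
  by rewrite ge0_integral_pushforward//; exact: measurable_affine.
by rewrite muleA -EFinM mulVf ?mul1e// normr_eq0.
Qed.
End affine_line.

(** * Integration over row vectors, one coordinate at a time *)

Section row_integral.
Context (R : realType).
Local Notation mR := (measurableTypeR R).
Local Notation mu := (@lebesgue_measure R).
Local Open Scope ereal_scope.

Definition row_integral n (f : 'rV[R]_n -> \bar R) : \bar R :=
  \int[lebesgue_tuple R n]_t f (row_of_tuple t).

Definition borel n (f : 'rV[R]_n -> \bar R) : Prop :=
  measurable_fun [set: n.-tuple mR] (f \o @row_of_tuple R n).

(** Peeling off the first coordinate, in step with the recursive definition of
    the Lebesgue measure on tuples. *)
Definition row_cons n (x : R) (v : 'rV[R]_n) : 'rV[R]_n.+1 :=
  row_mx (x%:M : 'M[R]_1) v.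

Lemma row_cons0 n x (v : 'rV[R]_n) : row_cons x v 0%R ord0 = x.
Proof.
by rewrite mxE; case: splitP => // j _; rewrite ord1 mxE.
Qed.

Lemma row_consS n x (v : 'rV[R]_n) i : row_cons x v 0%R (lift ord0 i) = v 0%R i.
Proof.
rewrite mxE; case: splitP => [j /= ji|j [ij]]; first by have := ltn_ord j; rewrite -ji.
by congr (v _ _); exact/val_inj.
Qed.

Lemma row_of_tuple_cons n (x : mR) (t : n.-tuple mR) :
  row_of_tuple (tuple_cons (x, t)) = row_cons x (row_of_tuple t).
Proof.
apply/rowP => i; rewrite mxE.
by case: (unliftP ord0 i) => [j ->|->]; rewrite ?row_cons0 ?row_consS ?tnthS ?mxE.
Qed.

Lemma row_integral_ge0 n (f : 'rV[R]_n -> \bar R) :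
  (forall v, 0 <= f v) -> 0 <= row_integral f.
Proof. by move=> f0; apply: integral_ge0 => t _; exact: f0. Qed.

Lemma le_row_integral n (f g : 'rV[R]_n -> \bar R) : borel f -> borel g ->
  (forall v, 0 <= f v) -> (forall v, f v <= g v) ->
  row_integral f <= row_integral g.
Proof. by move=> bf bg f0 fg; apply: ge0_le_integral => // t _; exact: f0. Qed.

Lemma eq_row_integral n (f g : 'rV[R]_n -> \bar R) :
  f =1 g -> row_integral f = row_integral g.
Proof. by move=> fg; congr row_integral; apply/funext. Qed.

Lemma row_integralZl n (c : \bar R) (f : 'rV[R]_n -> \bar R) :
  borel f -> (forall v, 0 <= f v) -> 0 <= c ->
  row_integral (fun v => c * f v) = c * row_integral f.
Proof. by move=> bf f0 c0; rewrite /row_integral ge0_integralZl// => t _; exact: f0. Qed.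

(** Measurability of a map into tuples can be checked coordinatewise. *)
Lemma borel_comp d (T : measurableType d) n (g : T -> 'rV[R]_n)
    (f : 'rV[R]_n -> \bar R) : borel f ->
  (forall i, measurable_fun [set: T] ((fun x => g x 0%R i) : T -> mR)) ->
  measurable_fun [set: T] (f \o g).
Proof.
move=> bf mg; pose h x : n.-tuple mR := [tuple g x 0%R i | i < n].
have -> : f \o g = (f \o @row_of_tuple R n) \o h.
  by apply/funext => x /=; congr f; apply/rowP => i; rewrite mxE tnth_mktuple.
apply: measurableT_comp => //; apply/measurable_fun_tnthP => i.
rewrite (_ : _ \o _ = (fun x => g x 0%R i : mR)); first exact: mg.
by apply/funext => x /=; rewrite tnth_mktuple.
Qed.

Lemma borel_coord n (i : 'I_n) :
  measurable_fun [set: n.-tuple mR]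
   ((fun t => row_of_tuple t 0%R i) : n.-tuple mR -> mR).
Proof. by under eq_fun do rewrite mxE; exact: measurable_tnth. Qed.

Lemma borel_comp_row n k (g : 'rV[R]_k -> 'rV[R]_n) (f : 'rV[R]_n -> \bar R) :
  borel f ->
  (forall i, measurable_fun [set: k.-tuple mR]
     ((fun t => g (row_of_tuple t) 0%R i) : k.-tuple mR -> mR)) ->
  borel (f \o g).
Proof. by move=> bf mg; exact: (@borel_comp _ _ _ (g \o @row_of_tuple R k)). Qed.

Lemma borel_linear n k (A : 'M[R]_(k, n)) (f : 'rV[R]_n -> \bar R) :
  borel f -> borel (fun v => f (v *m A)).
Proof.
move=> bf; apply: (@borel_comp_row _ _ (mulmx^~ A)) => // i.
under eq_fun do rewrite mxE.
apply: (@measurable_sum _ _ _ _ _ _ (fun j t => row_of_tuple t 0%R j * A j i)%R) => j.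
by apply: measurable_funM => //; exact: borel_coord.
Qed.

Lemma borel_translate n (u : 'rV[R]_n) (f : 'rV[R]_n -> \bar R) :
  borel f -> borel (fun v => f (v + u)%R).
Proof.
move=> bf; apply: (@borel_comp_row _ _ (fun v => v + u)%R) => // i.
under eq_fun do rewrite mxE.
by apply: measurable_funD => //; exact: borel_coord.
Qed.

Lemma borel_section n (x : R) (f : 'rV[R]_n.+1 -> \bar R) :
  borel f -> borel (fun v => f (row_cons x v)).
Proof.
move=> bf; apply: (@borel_comp_row _ _ (row_cons x)) => // i.
case: (unliftP ord0 i) => [j ->|->].
  by under eq_fun do rewrite row_consS; exact: borel_coord.
by under eq_fun do rewrite row_cons0; exact: measurable_cst.
Qed.

Lemma measurable_section n (v : 'rV[R]_n) (f : 'rV[R]_n.+1 -> \bar R) :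
  borel f -> measurable_fun [set: mR] (fun x => f (row_cons x v)).
Proof.
move=> bf; apply: (@borel_comp _ mR _ (fun x : mR => row_cons x v) f bf) => i.
case: (unliftP ord0 i) => [j ->|->].
  by under eq_fun do rewrite row_consS; exact: measurable_cst.
by under eq_fun do rewrite row_cons0; exact: measurable_id.
Qed.

Lemma borel_tuple_cons n (f : 'rV[R]_n.+1 -> \bar R) : borel f ->
  measurable_fun [set: mR * n.-tuple mR]
    (fun z => f (row_cons z.1 (row_of_tuple z.2))).
Proof.
move=> bf.
apply: (@borel_comp _ _ _ (fun z : mR * n.-tuple mR => row_cons z.1 (row_of_tuple z.2)) f bf) => i.
case: (unliftP ord0 i) => [j ->|->].
  under eq_fun do rewrite row_consS.
  exact: (measurableT_comp (borel_coord j) measurable_snd).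
by under eq_fun do rewrite row_cons0; exact: measurable_fst.
Qed.

Lemma row_integral0 (f : 'rV[R]_0 -> \bar R) : row_integral f = f 0%R.
Proof.
rewrite /row_integral integral_dirac//; last first.
  rewrite (_ : (fun _ => _) = cst (f 0%R)); first exact: measurable_cst.
  by apply/funext => t; congr f; apply/rowP => -[].
by rewrite diracT mul1e; congr f; apply/rowP => -[].
Qed.

Section tonelli.
Context n (f : 'rV[R]_n.+1 -> \bar R).
Hypotheses (bf : borel f) (f0 : forall v, 0 <= f v).

Let row_integral_prod : row_integral f =
  \int[mu \x lebesgue_tuple R n]_z f (row_cons z.1 (row_of_tuple z.2)).
Proof.
rewrite /row_integral /= ge0_integral_pushforward//.
- by apply: eq_integral => -[x t] _ /=; rewrite row_of_tuple_cons.
- exact: measurable_tuple_cons.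
Qed.

Lemma row_integralS : row_integral f =
  \int[mu]_x row_integral (fun v => f (row_cons x v)).
Proof.
rewrite row_integral_prod fubini_tonelli1//; exact: borel_tuple_cons.
Qed.

Lemma row_integralS_swap : row_integral f =
  row_integral (fun v => \int[mu]_x f (row_cons x v)).
Proof.
rewrite row_integralS.
by apply: (fubini_tonelli _ (borel_tuple_cons bf)) => z; exact: f0.
Qed.

Lemma measurable_row_integral :
  measurable_fun [set: mR] (fun x => row_integral (fun v => f (row_cons x v))).
Proof.
by apply: (measurable_fun_fubini_tonelli_F _ (borel_tuple_cons bf)) => z; exact: f0.
Qed.
End tonelli.

End row_integral.

(** * Linear changes of variable *)

Section linear_change.
Context (R : realType).
Local Notation mR := (measurableTypeR R).
Local Notation mu := (@lebesgue_measure R).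

Lemma row_consE n (v : 'rV[R]_n.+1) :
  v = row_cons (v 0 ord0) (\row_i v 0 (lift ord0 i)).
Proof.
apply/rowP => i; case: (unliftP ord0 i) => [j ->|->].
  by rewrite row_consS mxE.
by rewrite row_cons0.
Qed.

Lemma row_consD n x y (v w : 'rV[R]_n) :
  row_cons x v + row_cons y w = row_cons (x + y) (v + w).
Proof.
apply/rowP => i; rewrite mxE; case: (unliftP ord0 i) => [j ->|->].
  by rewrite !row_consS mxE.
by rewrite !row_cons0.
Qed.

(** Tonelli reduces the claim to translations of the first coordinate. *)
Lemma row_integral_translate n (u : 'rV[R]_n) (f : 'rV[R]_n -> \bar R) :
  borel f -> (forall v, 0 <= f v)%E ->
  row_integral (fun v => f (v + u)) = row_integral f.
Proof.
elim: n u f => [u f _ _|n IH u f bf f0].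
  by rewrite !row_integral0; congr f; apply/rowP => -[].
rewrite (row_consE u); set a := u 0 ord0; set u' := \row_i _.
rewrite [LHS]row_integralS//; last exact: borel_translate.
transitivity (\int[mu]_x row_integral (fun v => f (row_cons (1 * x + a)%R v)))%E.
  apply: eq_integral => x _.
  rewrite -[RHS](IH u')//; last exact: borel_section.
  by apply: eq_row_integral => v; rewrite row_consD mul1r.
rewrite (@ge0_integral_affine _ _ _ (fun x => row_integral (fun v => f (row_cons x v))))//.
- by rewrite normr1 invr1 mul1e -row_integralS.
- exact: measurable_row_integral.
- by move=> x; apply: row_integral_ge0.
Qed.

Definition scales_integral n (A : 'M[R]_n) := forall f : 'rV[R]_n -> \bar R,
  borel f -> (forall v, 0 <= f v)%E ->
  row_integral (fun v => f (v *m A)) = (`|\det A|^-1%:E * row_integral f)%E.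

(** The matrices satisfying the change of variables formula are closed under
    products, so it is enough to factor an invertible matrix into block
    triangular ones. *)
Lemma scales_integralM n (A B : 'M[R]_n) :
  scales_integral A -> scales_integral B -> scales_integral (A *m B).
Proof.
move=> gA gB f bf f0.
under eq_row_integral do rewrite mulmxA.
rewrite (gA (fun w => f (w *m B)))//; last exact: borel_linear.
by rewrite gB// det_mulmx normrM invfM EFinM muleA.
Qed.

Lemma row_cons_mul n x (v : 'rV[R]_n) (a : R) (b : 'rV[R]_n) (c : 'cV[R]_n)
    (D : 'M[R]_n) :
  row_cons x v *m (block_mx (a%:M : 'M[R]_1) b c D : 'M[R]_(1 + n)) =
  row_cons (x * a + (v *m c) 0 0) (x *: b + v *m D).
Proof.
rewrite [LHS](mul_row_block (x%:M : 'M[R]_1) v) mul_scalar_mx scale_scalar_mx.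
rewrite mul_scalar_mx; congr (row_mx _ _); rewrite raddfD /=; congr (_ + _); exact: mx11_scalar.
Qed.

(** Integrating over the last coordinates first, the row b only translates
    the argument; then the first coordinate is scaled by a. *)
Lemma scales_integral_ublock n (a : R) (b : 'rV[R]_n) (D : 'M[R]_n) :
  a != 0 -> scales_integral D ->
  scales_integral (block_mx (a%:M : 'M[R]_1) b 0 D : 'M[R]_(1 + n)).
Proof.
move=> a0 gD f bf f0.
rewrite [LHS]row_integralS//; last exact: borel_linear.
pose G x := row_integral (fun v => f (row_cons x v)).
have G0 x : (0 <= G x)%E by exact: row_integral_ge0.
have mG : measurable_fun [set: mR] G by exact: measurable_row_integral.
transitivity (\int[mu]_x (`|\det D|^-1%:E * G (a * x + 0)%R))%E.
  apply: eq_integral => x _.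
  have bfx := borel_section (a * x) bf.
  rewrite addr0 /G -(row_integral_translate (x *: b) bfx)//.
  rewrite -(gD (fun v => f (row_cons (a * x) (v + x *: b))))//; last first.
    exact: (borel_translate _ bfx).
  apply: eq_row_integral => v.
  by rewrite row_cons_mul mulmx0 mxE addr0 mulrC addrC.
rewrite ge0_integralZl_EFin ?invr_ge0//; last first.
  apply: (measurableT_comp (f := G)) => //; exact: measurable_affine.
rewrite ge0_integral_affine// det_ublock det_scalar1 normrM invfM EFinM.
by rewrite muleCA muleA /G -row_integralS.
Qed.

(** Integrating over the first coordinate first, the column c only translates
    it. *)
Lemma scales_integral_lblock n (c : 'cV[R]_n) :
  scales_integral (block_mx (1%:M : 'M[R]_1) 0 c 1%:M : 'M[R]_(1 + n)).
Proof.
move=> f bf f0.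
rewrite [LHS]row_integralS_swap//; last exact: borel_linear.
rewrite det_lblock !det1 mulr1 normr1 invr1 mul1e row_integralS_swap//.
apply: eq_row_integral => v.
under eq_integral do rewrite row_cons_mul scaler0 add0r mulmx1 mulr1 -[X in (X + _)%R]mul1r.
rewrite (@ge0_integral_affine _ 1 _ (fun x => f (row_cons x v)))//.
- by rewrite normr1 invr1 mul1e.
- exact: measurable_section.
Qed.

(** Block elimination: the matrix is the product of a unipotent lower block
    matrix and an upper block matrix whose lower right block is the Schur
    complement. *)
Lemma scales_integral_pivot n (a : R) (b : 'rV[R]_n) (c : 'cV[R]_n)
    (D : 'M[R]_n) : a != 0 ->
  (forall D' : 'M[R]_n, D' \in unitmx -> scales_integral D') ->
  (block_mx (a%:M : 'M[R]_1) b c D : 'M[R]_(1 + n)) \in unitmx ->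
  scales_integral (block_mx (a%:M : 'M[R]_1) b c D : 'M[R]_(1 + n)).
Proof.
move=> a0 IH.
have -> : (block_mx (a%:M : 'M[R]_1) b c D : 'M[R]_(1 + n)) =
    block_mx (1%:M : 'M[R]_1) 0 (a^-1 *: c) 1%:M *m
    block_mx (a%:M : 'M[R]_1) b 0 (D - (a^-1 *: c) *m b).
  rewrite mulmx_block !mul1mx !mul0mx !addr0 (addrC (_ *m b)) subrK.
  by rewrite mul_mx_scalar scalerA divff// scale1r.
rewrite unitmx_mul => /andP[_].
rewrite unitmxE det_ublock unitrM => /andP[_ uD].
apply: scales_integralM; first exact: scales_integral_lblock.
by apply: scales_integral_ublock => //; apply: IH; rewrite unitmxE.
Qed.

(** Induction on the dimension by block elimination. Shears take the
    place of row exchanges when the pivot vanishes. *)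
Theorem row_integral_linear n (A : 'M[R]_n) : A \in unitmx -> scales_integral A.
Proof.
elim: n A => [A _ f _ _|n IH A uA].
  rewrite det_mx00 normr1 invr1 mul1e; apply: eq_row_integral => v.
  by congr f; apply/rowP => -[].
pose a := (A : 'M[R]_(1 + n)) 0 0.
pose b := ursubmx (A : 'M[R]_(1 + n)).
pose c := dlsubmx (A : 'M[R]_(1 + n)).
pose D := drsubmx (A : 'M[R]_(1 + n)).
have AE : A = block_mx (a%:M : 'M[R]_1) b c D :> 'M[R]_(1 + n).
  rewrite -[LHS](@submxK _ 1 n 1 n); congr block_mx.
  by rewrite [LHS]mx11_scalar; congr (_%:M); rewrite !mxE; congr (A _ _); exact/val_inj.
have [a0|a0] := eqVneq a 0; last first.
  by rewrite AE; apply: scales_integral_pivot; rewrite -?AE.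
have c0 : c != 0.
  apply: contraTneq uA => c0; rewrite unitmxE AE c0 [\det _](@det_ublock _ 1 n) det_scalar1 a0 mul0r.
  by rewrite unitr0.
(* Adding the combination u of the lower rows to the first row turns the
   vanishing pivot into the squared norm of the column c. *)
pose u := c^T.
have uc0 : (u *m c) 0 0 != 0.
  apply: contraNneq c0; rewrite mxE => /eqP; rewrite psumr_eq0; last first.
    by move=> i _; rewrite mxE -expr2 sqr_ge0.
  move=> /allP uc; apply/eqP/colP => i; rewrite [RHS]mxE.
  by have := uc i (mem_index_enum _); rewrite /= mxE mulf_eq0 orbb => /eqP.
have AE' : A = (block_mx (1%:M : 'M[R]_1) (- u) 0 1%:M : 'M[R]_(1 + n)) *m
   (block_mx (((u *m c) 0 0)%:M : 'M[R]_1) (b + u *m D) c D : 'M[R]_(1 + n)).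
  rewrite AE mulmx_block !mul1mx !mul0mx !add0r !mulNmx addrK a0.
  by rewrite -mx11_scalar subrr raddf0.
move: uA; rewrite AE' unitmx_mul => /andP[_ uA'].
apply: scales_integralM; last exact: scales_integral_pivot.
apply: scales_integral_ublock; first exact: oner_neq0.
exact/IH/unitmx1.
Qed.
End linear_change.

(** * Finner's inequality *)

Section finner.
Context (R : realType).
Local Notation mR := (measurableTypeR R).
Local Notation mu := (@lebesgue_measure R).

(** Multiplying a function that ignores the coordinates in P by this indicator
    turns an integral over the remaining coordinates into one over the whole
    space, which avoids spaces of varying dimension. *)
Definition box n (P : pred 'I_n) (v : 'rV[R]_n) : R :=
  \prod_(i | P i) (0 <= v 0 i <= 1)%R%:R.

Lemma box_ge0 n (P : pred 'I_n) v : 0 <= box P v.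
Proof. by apply: prodr_ge0 => i _; exact: ler0n. Qed.

Lemma box_cons n (P : pred 'I_n.+1) x v : box P (row_cons x v) =
  (if P ord0 then (0 <= x <= 1)%R%:R else 1) * box (fun i => P (lift ord0 i)) v.
Proof.
rewrite /box !(big_mkcond (fun i => P _)) big_mkcond big_ord_recl row_cons0.
by congr (_ * _); apply: eq_bigr => i _; rewrite row_consS.
Qed.

Lemma measurable_unit_indic :
  measurable_fun [set: mR] (fun x : mR => ((0 <= x <= 1)%R%:R : mR)).
Proof.
rewrite (_ : (fun _ => _) = \1_(`[0, 1]%classic : set mR)).
  by apply: measurable_indic; exact: measurable_itv.
by apply/funext => x; rewrite indicE mem_setE in_itv.
Qed.

Lemma integral_unit_indic : (\int[mu]_x ((0 <= x <= 1)%R%:R)%:E = 1)%E.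
Proof.
under eq_integral.
  move=> x _; rewrite (_ : _%:R = \1_(`[0, 1]%classic : set mR) x); last first.
    by rewrite indicE mem_setE in_itv.
  over.
rewrite integral_indic//.
by rewrite setIT [LHS]lebesgue_measure_itv/= lte_fin ltr01 oppr0 adde0.
Qed.

Lemma borel_box n (P : pred 'I_n) : borel (fun v => (box P v)%:E).
Proof.
rewrite /borel (_ : _ \o _ = EFin \o (fun t : n.-tuple mR => \prod_i
  (if P i then (0 <= row_of_tuple t 0 i <= 1)%R%:R else 1) : R)); last first.
  by apply/funext => t /=; rewrite /box big_mkcond.
apply/measurable_EFinP; apply: measurable_prod => i _.
case: (P i); last exact: measurable_cst.
exact: (measurableT_comp measurable_unit_indic (borel_coord i)).
Qed.

Lemma row_integral_box n : (row_integral (fun v => (box (@predT 'I_n) v)%:E) = 1)%E.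
Proof.
elim: n => [|n IH]; first by rewrite row_integral0 /box big_ord0.
rewrite row_integralS; last by move=> v; rewrite lee_fin box_ge0.
  under eq_integral => x _.
    under eq_row_integral do rewrite box_cons EFinM.
    rewrite row_integralZl; last 3 first.
    - exact: borel_box.
    - by move=> v; rewrite lee_fin box_ge0.
    - by rewrite lee_fin.
    rewrite IH mule1.
  over.
  exact: integral_unit_indic.
exact: borel_box.
Qed.

Lemma borelM n (f g : 'rV[R]_n -> \bar R) :
  borel f -> borel g -> borel (fun v => f v * g v)%E.
Proof. by move=> bf bg; exact: emeasurable_funM. Qed.

Lemma borel_poweR n (f : 'rV[R]_n -> \bar R) r :
  borel f -> borel (fun v => f v `^ r)%E.
Proof. exact: measurable_poweRT. Qed.

Lemma borel_prod n m (f : 'I_m -> 'rV[R]_n -> \bar R) :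
  (forall j, borel (f j)) -> borel (fun v => \big[*%E/1]_j f j v)%E.
Proof. by move=> bf; apply: emeasurable_prod => j _; exact: bf. Qed.

(** Induction on the dimension. For a fixed first coordinate x the induction
    hypothesis bounds the integral over the others by a product of powers of
    functions I_j(x). Those I_j for which S_j misses the first coordinate are
    constant in x, and the weights of the others sum to 1 because the first
    coordinate is covered, so that Hoelder's inequality applies to them. *)
Theorem finner n m (p : 'I_m -> R) (S : 'I_m -> pred 'I_n)
    (H : 'I_m -> 'rV[R]_n -> \bar R) :
  (forall j, 0 < p j) -> (forall i, \sum_j p j * (S j i)%:R = 1) ->
  (forall j, borel (H j)) -> (forall j v, 0 <= H j v)%E ->
  (forall j (u v : 'rV[R]_n), (forall i, S j i -> u 0 i = v 0 i) -> H j u = H j v) ->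
  (row_integral (fun v => \big[*%E/1]_j (H j v `^ p j)) <=
   \big[*%E/1]_j
     (row_integral (fun v => H j v * (box (predC (S j)) v)%:E)) `^ p j)%E.
Proof.
move=> p0; elim: n S H => [|n IH] S H cov bH H0 indep.
  rewrite row_integral0 le_eqVlt; apply/orP; left; apply/eqP.
  by apply: eq_bigr => j _; rewrite row_integral0 /box big_ord0 mule1.
pose S' j i := S j (lift ord0 i).
pose K j x v := (H j (row_cons x v) * (box (predC (S' j)) v)%:E)%E.
pose I j x := row_integral (K j x).
have K0 j x v : (0 <= K j x v)%E by rewrite mule_ge0// lee_fin box_ge0.
have I0 j x : (0 <= I j x)%E by exact: row_integral_ge0.
have bK j : borel (fun v : 'rV[R]_n.+1 => K j (v 0 ord0) (\row_i v 0 (lift ord0 i))).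
  apply: borelM.
    by under eq_fun do rewrite -row_consE; exact: bH.
  apply: (@borel_comp_row _ _ _ (fun v => \row_i v 0 (lift ord0 i)) (fun v => (box (predC (S' j)) v)%:E)).
    exact: borel_box.
  by move=> i; under eq_fun do rewrite mxE; exact: borel_coord.
have KE j x v : K j x v = K j (row_cons x v 0 ord0) (\row_i row_cons x v 0 (lift ord0 i)).
  by rewrite row_cons0; congr (K _ _ _); apply/rowP => i; rewrite mxE row_consS.
have mI j : measurable_fun [set: mR] (I j).
  rewrite (_ : I j = fun x => row_integral (fun v => (fun v : 'rV[R]_n.+1 => K j (v 0 ord0) (\row_i v 0 (lift ord0 i))) (row_cons x v))); last first.
    by apply/funext => x; apply: eq_row_integral => v; exact: KE.
  exact: (measurable_row_integral (bK j)).
have prod0 k (F : 'I_m -> k -> \bar R) (P : pred 'I_m) x : (0 <= \big[*%E/1]_(j | P j) (F j x `^ p j))%E.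
  by apply: prode_ge0 => j _; exact: poweR_ge0.
have bprod : borel (fun v => \big[*%E/1]_j (H j v `^ p j))%E.
  by apply: borel_prod => j; exact: borel_poweR.
rewrite row_integralS//.
apply: (@le_trans _ _ (\int[mu]_x \big[*%E/1]_j (I j x `^ p j))%E).
  apply: ge0_le_integral => //.
  - by move=> x _; apply: row_integral_ge0 => v; exact: prod0.
  - exact: (measurable_row_integral bprod (fun v => prod0 _ _ _ v)).
  - by apply: emeasurable_prod => j _; exact: measurable_poweRT.
  - move=> x _; apply: (IH S' (fun j v => H j (row_cons x v))) => //.
    + by move=> i; exact: cov.
    + by move=> j; exact: borel_section.
    + move=> j u v uv; apply: indep => i; case: (unliftP ord0 i) => [k ->|->].
        by rewrite !row_consS; exact: uv.
      by rewrite !row_cons0.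
have Icst j x : ~~ S j ord0 -> I j x = I j 0.
  move=> Sj; apply: eq_row_integral => v; congr (_ * _)%E; apply: indep => i.
  case: (unliftP ord0 i) => [k ->|->]; first by rewrite !row_consS.
  by rewrite (negbTE Sj).
(* The factors that do not depend on x leave the integral. *)
pose c := (\big[*%E/1]_(j | ~~ S j ord0) (I j 0%R `^ p j))%E.
have split_prod x : (\big[*%E/1]_j (I j x `^ p j) =
    c * \big[*%E/1]_(j | S j ord0) (I j x `^ p j))%E.
  rewrite (bigID (fun j => S j ord0))/= muleC; congr (_ * _)%E.
  by apply: eq_bigr => j Sj; rewrite Icst.
under eq_integral do rewrite split_prod.
rewrite ge0_integralZl//; last 2 first.
- by apply: emeasurable_prod => j _; exact: measurable_poweRT.
- exact: (prod0 R (fun j _ => I j 0) _ 0).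
rewrite [leRHS](bigID (fun j => S j ord0))/= muleC.
have bHbox j : borel (fun v => H j v * (box (predC (S j)) v)%:E)%E.
  by apply: borelM => //; exact: borel_box.
have Hbox0 j v : (0 <= H j v * (box (predC (S j)) v)%:E)%E.
  by rewrite mule_ge0// lee_fin box_ge0.
apply: lee_pmul.
- by apply: integral_ge0 => x _; exact: prod0.
- exact: (prod0 R (fun j _ => I j 0) _ 0).
- apply: le_trans (hoelder_prod mu _ _ _ _) _ => //.
  + rewrite -(cov ord0) big_mkcond; apply: eq_bigr => j _.
    by case: (S j ord0); rewrite (mulr1, mulr0).
  + rewrite le_eqVlt; apply/orP; left; apply/eqP; apply: eq_bigr => j Sj.
    rewrite [in RHS](row_integralS (bHbox j) (Hbox0 j)).
    apply: (congr1 (fun z => z `^ p j)%E).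
    apply: eq_integral => x _.
    by apply: eq_row_integral => v; rewrite box_cons /= Sj mul1r.
- rewrite le_eqVlt; apply/orP; left; apply/eqP; apply: eq_bigr => j Sj.
  rewrite [in RHS](row_integralS (bHbox j) (Hbox0 j)).
  apply: (congr1 (fun z => z `^ p j)%E).
  transitivity (\int[mu]_x (I j 0%R * ((0 <= x <= 1)%R%:R)%:E))%E.
    rewrite ge0_integralZl//.
    + by rewrite integral_unit_indic mule1.
    + by apply/measurable_EFinP; exact: measurable_unit_indic.
  apply: eq_integral => x _; rewrite -(Icst j x Sj) muleC -row_integralZl//.
    by apply: eq_row_integral => v; rewrite box_cons /= Sj EFinM muleCA.
  by apply: borelM; [exact: borel_section|exact: borel_box].
Qed.

End finner.

(** * Restriction to a set of coordinates *)

Section selection.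
Context (R : realType).

(** Right multiplication by its transpose restricts a row vector to the
    coordinates in S; left multiplication by it selects the rows in S. *)
Definition sel n (S : {set 'I_n}) : 'M[R]_(#|S|, n) := rowsub (@enum_val _ (mem S)) 1%:M.

Lemma selE n (S : {set 'I_n}) i j : sel S i j = (enum_val i == j)%:R.
Proof. by rewrite !mxE. Qed.

Lemma mul_sel_tr n k (S : {set 'I_n}) (y : 'M[R]_(k, n)) a i :
  (y *m (sel S)^T) a i = y a (enum_val i).
Proof.
rewrite mxE (bigD1 (enum_val i))//= mxE selE eqxx mulr1 big1 ?addr0// => j ji.
by rewrite mxE selE eq_sym (negbTE ji) mulr0.
Qed.

Lemma mul_sel n k (S : {set 'I_n}) (A : 'M[R]_(n, k)) i a :
  (sel S *m A) i a = A (enum_val i) a.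
Proof. by rewrite -rowsubE mxE. Qed.

Lemma sel_orthonormal n (S : {set 'I_n}) : sel S *m (sel S)^T = 1%:M.
Proof. by apply/matrixP => i j; rewrite mul_sel_tr selE mxE (inj_eq enum_val_inj). Qed.

Lemma sel_disjoint n (S : {set 'I_n}) : sel S *m (sel (~: S))^T = 0.
Proof.
apply/matrixP => i j; rewrite mul_sel_tr selE mxE.
case: eqP => // ij; have := enum_valP j; rewrite -ij inE.
by rewrite (enum_valP i).
Qed.

Lemma sel_disjointC n (S : {set 'I_n}) : sel (~: S) *m (sel S)^T = 0.
Proof. by rewrite -[LHS]trmxK trmx_mul trmxK sel_disjoint trmx0. Qed.

Lemma sel_projector n (S : {set 'I_n}) a b :
  ((sel S)^T *m sel S) a b = ((a \in S) && (a == b))%:R.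
Proof.
rewrite mxE (eq_bigr (fun i => (enum_val i == a)%:R * (enum_val i == b)%:R)); last first.
  by move=> i _; rewrite mxE !selE.
rewrite -(@big_enum_val _ _ _ _ (mem S) (fun x => (x == a)%:R * (x == b)%:R : R)).
have [aS|aS] := boolP (a \in S).
  rewrite (bigD1 a)//= eqxx mul1r big1 ?addr0// => i /andP[_ ia].
  by rewrite (negbTE ia) mul0r.
rewrite big1// => i iS; case: eqP => [ia|_]; last by rewrite mul0r.
by move: aS; rewrite -ia; move: iS => /= ->.
Qed.

(** Restricting to S and to its complement and extending both by zero recovers
    the vector. *)
Lemma sel_complete n (S : {set 'I_n}) :
  (sel S)^T *m sel S + (sel (~: S))^T *m sel (~: S) = 1%:M.
Proof.
apply/matrixP => a b; rewrite [LHS]mxE !sel_projector inE !mxE.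
by case: (a \in S); rewrite ?addr0 ?add0r.
Qed.

End selection.

(** * Volumes as Gram determinants *)

Section gram.
Context (R : realType).

(** Volume of the parallelepiped spanned by the rows of A; it makes sense for
    rectangular A, so no choice of coordinates on the span is involved. *)
Definition vol k n (A : 'M[R]_(k, n)) : R := Num.sqrt (\det (A *m A^T)).

Lemma vol_square n (A : 'M[R]_n) : vol A = `|\det A|.
Proof. by rewrite /vol det_mulmx det_tr -expr2 sqrtr_sqr. Qed.

(** Equality of the dimensions is a hypothesis rather than a unification,
    because they arise as ranks and cardinals that are only provably equal; the
    same holds for the lemmas below. *)
Lemma det_congruence k l (e : k = l) (C : 'M[R]_(k, l)) (G : 'M[R]_l) :
  \det (C *m G *m C^T) = \det (C *m C^T) * \det G.
Proof. by subst l; rewrite !det_mulmx mulrAC. Qed.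

Lemma det_gram_tr k l (e : k = l) (C : 'M[R]_(k, l)) :
  \det (C *m C^T) = \det (C^T *m C).
Proof. by subst l; rewrite !det_mulmx mulrC. Qed.

Lemma det_gram_ge0 k n (A : 'M[R]_(k, n)) (e : k = n) : 0 <= \det (A *m A^T).
Proof. by subst n; rewrite det_mulmx det_tr -expr2 sqr_ge0. Qed.

Lemma row_integral_vol n N (Q : 'M[R]_(N, n)) (f : 'rV[R]_N -> \bar R) :
  N = n -> vol Q != 0 -> borel f -> (forall v, 0 <= f v)%E ->
  (row_integral (fun v => f (v *m Q^T)) = (vol Q)^-1%:E * row_integral f)%E.
Proof.
move=> e; subst n; rewrite vol_square normr_eq0 => Q0 bf f0.
have uQ : Q^T \in unitmx by rewrite unitmx_tr unitmxE unitfE.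
by rewrite (row_integral_linear uQ)// det_tr.
Qed.

Lemma borel_cylinder k l (h : 'rV[R]_k -> \bar R) : borel h ->
  borel (fun z : 'rV[R]_(k + l) => h (lsubmx z) * (box predT (rsubmx z))%:E)%E.
Proof.
move=> bh; apply: borelM.
  apply: (borel_comp_row (g := lsubmx)) => // i.
  by under eq_fun do rewrite mxE; exact: borel_coord.
apply: (borel_comp_row (g := rsubmx) (f := fun v => (box predT v)%:E)).
  exact: borel_box.
by move=> i; under eq_fun do rewrite mxE; exact: borel_coord.
Qed.

(** The unit box on the last coordinates has integral 1. *)
Lemma row_integral_cylinder k l (h : 'rV[R]_k -> \bar R) :
  borel h -> (forall v, 0 <= h v)%E ->
  (row_integral (fun z : 'rV[R]_(k + l) =>
    h (lsubmx z) * (box predT (rsubmx z))%:E) = row_integral h)%E.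
Proof.
elim: k h => [|k IH] h bh h0.
  transitivity (row_integral (fun z : 'rV[R]_l => h 0%R * (box predT z)%:E))%E.
    apply: eq_row_integral => z; rewrite (_ : lsubmx z = 0); last first.
      by apply/rowP => -[].
    congr (_ * (box _ _)%:E)%E.
    by apply/rowP => i; rewrite mxE; congr (z _ _); exact/val_inj.
  rewrite row_integralZl//; last 2 first.
  - exact: borel_box.
  - by move=> v; rewrite lee_fin box_ge0.
  by rewrite row_integral_box mule1 row_integral0.
have lsub_cons x (z : 'rV[R]_(k + l)) :
    lsubmx (row_cons x z : 'rV[R]_(k.+1 + l)) = row_cons x (lsubmx z).
  apply/rowP => i; rewrite mxE; case: (unliftP ord0 i) => [j ->|->].
    rewrite (_ : lshift l (lift ord0 j) = lift ord0 (lshift l j)); last exact/val_inj.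
    by rewrite !row_consS mxE.
  rewrite (_ : lshift l ord0 = ord0 :> 'I_(k + l).+1); last exact/val_inj.
  by rewrite !row_cons0.
have rsub_cons x (z : 'rV[R]_(k + l)) :
    rsubmx (row_cons x z : 'rV[R]_(k.+1 + l)) = rsubmx z.
  apply/rowP => i; rewrite mxE [RHS]mxE.
  rewrite (_ : rshift k.+1 i = lift ord0 (rshift k i) :> 'I_(k + l).+1); last exact/val_inj.
  by rewrite row_consS.
rewrite [LHS](@row_integralS _ (k + l)); last 2 first.
- exact: (@borel_cylinder k.+1 l).
- by move=> v; rewrite mule_ge0// lee_fin box_ge0.
rewrite row_integralS//; apply: eq_integral => x _.
rewrite -(IH (fun v => h (row_cons x v)))//; last exact: borel_section.
by apply: eq_row_integral => z; rewrite lsub_cons rsub_cons.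
Qed.

End gram.

Section fibers.
Context (R : realType).
Local Notation mR := (measurableTypeR R).

(** C holds the coordinates of an orthonormal family in the basis formed by the
    rows of A, and a change of basis multiplies volumes. *)
Lemma vol_coord k l n (e : k = l) (C : 'M[R]_(k, l)) (A : 'M[R]_(l, n)) :
  (C *m A) *m (C *m A)^T = 1%:M -> vol C * vol A = 1.
Proof.
rewrite trmx_mul mulmxA -(mulmxA C) => CA.
rewrite /vol -sqrtrM ?det_gram_ge0// -(det_congruence e) CA det1.
exact: sqrtr1.
Qed.

Lemma vol_tr k l (e : k = l) (C : 'M[R]_(k, l)) : vol C^T = vol C.
Proof. by rewrite /vol trmxK det_gram_tr. Qed.

Lemma orthonormal_row_free k n (B : 'M[R]_(k, n)) : B *m B^T = 1%:M -> row_free B.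
Proof. by move=> B1; apply/row_freeP; exists B^T. Qed.

Lemma sel_unit_free n (W : 'M[R]_n) S : W \in unitmx -> row_free (sel R S *m W).
Proof.
move=> uW; apply/row_freeP; exists (invmx W *m (sel R S)^T).
by rewrite mulmxA mulmxK// sel_orthonormal.
Qed.

Lemma box_sel n (S : {set 'I_n}) (y : 'rV[R]_n) :
  box (predC (mem S)) y = box predT (y *m (sel R (~: S))^T).
Proof.
rewrite /box (eq_bigl (mem (~: S)%SET)); last by move=> i; rewrite /= inE.
rewrite (big_enum_val _) /=.
by apply: eq_bigr => i _; rewrite mul_sel_tr.
Qed.

Section fiber.
Context k n (B : 'M[R]_(k, n)) (W : 'M[R]_n) (S : {set 'I_n}).
Hypotheses (B1 : B *m B^T = 1%:M) (uW : W \in unitmx)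
  (BW : (B :=: sel R S *m W)%MS).

Lemma fiber_dim : k = #|S|.
Proof.
have /eqP <- := orthonormal_row_free B1; rewrite BW.
by apply/eqP; exact: sel_unit_free.
Qed.

(** The map from y to the pair formed by the coordinates of the projection in
    the basis B and by the restriction of y to the complement of S is linear.
    Its Gram matrix is block diagonal, with blocks C C^T and 1, where B = C W_S
    for W_S the rows of W with index in S; so the map multiplies volumes by
    vol C = 1 / vol W_S. *)
Lemma row_integral_fiber (h : 'rV[R]_k -> \bar R) :
  borel h -> (forall v, 0 <= h v)%E ->
  (row_integral (fun y => h (y *m (invmx W)^T *m B^T)%R *
      (box (predC (mem S)) y)%:E) =
   (vol (sel R S *m W))%:E * row_integral h)%E.
Proof.
move=> bh h0.
have /submxP[C CE] : (B <= sel R S *m W)%MS by rewrite BW.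
pose Q := col_mx (C *m sel R S) (sel R (~: S)).
have volC : vol C * vol (sel R S *m W) = 1.
  by apply: (vol_coord fiber_dim); rewrite -CE.
have volQ : vol Q = vol C.
  have CC : C *m sel R S *m (C *m sel R S)^T = C *m C^T.
    by rewrite trmx_mul mulmxA -(mulmxA C) sel_orthonormal mulmx1.
  have C0 : sel R (~: S) *m (C *m sel R S)^T = 0.
    by rewrite trmx_mul mulmxA sel_disjointC mul0mx.
  rewrite /vol /Q tr_col_mx mul_col_row CC C0 sel_orthonormal.
  by rewrite det_ublock det1 mulr1.
have volQ0 : vol Q != 0.
  rewrite volQ; apply: contra_eqN volC => /eqP ->; rewrite mul0r eq_sym.
  exact: oner_neq0.
have dimQ : (k + #|~: S|)%N = n by rewrite fiber_dim cardsC card_ord.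
have <- : (vol Q)^-1 = vol (sel R S *m W).
  by apply: (mulfI volQ0); rewrite divff// volQ volC.
rewrite -(@row_integral_cylinder _ _ #|~: S| h)// -row_integral_vol//; last 2 first.
- exact: borel_cylinder.
- by move=> v; rewrite mule_ge0// lee_fin box_ge0.
apply: eq_row_integral => y.
rewrite /Q tr_col_mx mul_mx_row row_mxKl row_mxKr box_sel.
congr (h _ * _)%E; rewrite CE mulmxA [(_ *m W)^T]trmx_mul mulmxA -(mulmxA y).
by rewrite -trmx_mul mulmxV// trmx1 mulmx1.
Qed.
End fiber.

Lemma basis_unitmx n (w : 'I_n -> 'rV[R]_n) :
  basis_of fullv [seq w i | i : 'I_n] -> \matrix_i w i \in unitmx.
Proof.
move=> /andP[_ fw]; rewrite -row_free_unit; apply/inj_row_free => v.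
have /freeP fw' : free (mktuple w) by [].
move=> vW; apply/rowP => i; rewrite [RHS]mxE; apply: fw'.
under eq_bigr => j _ do rewrite -tnth_nth tnth_mktuple.
rewrite -[RHS]vW mulmx_sum_row; apply: eq_bigr => j _; by rewrite rowK.
Qed.

Lemma lin_spanE n (w : 'I_n -> 'rV[R]_n) S :
  (lin_span w S :=: sel R S *m \matrix_i w i)%MS.
Proof.
apply/eqmxP/andP; split.
  apply/sumsmx_subP => i iS; rewrite genmxE.
  suff -> : w i = row (enum_rank_in iS i) (sel R S *m \matrix_i w i) by exact: row_sub.
  by apply/rowP => j; rewrite mxE mul_sel mxE enum_rankK_in.
apply/row_subP => i; rewrite (_ : row i _ = w (enum_val i)).
  by apply: (sumsmx_sup (enum_val i)); rewrite ?genmxE// enum_valP.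
by apply/rowP => j; rewrite mxE mul_sel mxE.
Qed.

Lemma sum_sel n (w : 'I_n -> 'rV[R]_n) (S : {set 'I_n}) (c : 'I_n -> R) :
  \sum_(k in S) c k *: w k =
  (\row_i c (enum_val i)) *m (sel R S *m \matrix_i w i).
Proof.
rewrite (big_enum_val (fun k => c k *: w k)) mulmx_sum_row.
apply: eq_bigr => i _; rewrite mxE; congr (_ *: _).
by apply/rowP => j; rewrite mxE mul_sel mxE.
Qed.

Lemma boxTE n (v : 'rV[R]_n) : box predT v = [forall i, 0 <= v 0 i <= 1]%:R.
Proof.
rewrite /box; case: forallP => [h|/forallP].
  by rewrite big1// => i _; rewrite h.
rewrite negb_forall => /existsP[i vi].
by rewrite (bigD1 i)//= (negbTE vi) mul0r.
Qed.

(** In the orthonormal coordinates of the span, the parallelepiped is the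
    preimage of the unit cube under the invertible map s |-> s C, where C is
    the inverse of the matrix of coordinates of the w_k; so its volume is
    1 / vol C. *)
Lemma wedge_normE n (w : 'I_n -> 'rV[R]_n) S : \matrix_i w i \in unitmx ->
  wedge_norm w S = vol (sel R S *m \matrix_i w i).
Proof.
set W := \matrix_i w i => uW; rewrite /wedge_norm.
set F := lin_span w S.
have FE : (F :=: sel R S *m W)%MS by exact: lin_spanE.
have rF : \rank F = #|S| by rewrite FE; apply/eqP; exact: sel_unit_free.
rewrite rF eqxx /subspace_lebesgue /isometry_onto.
rewrite /orthonormal_basis; case: cid => B /= [B1 BF].
have BW : (B :=: sel R S *m W)%MS := eqmx_trans BF FE.
have /submxP[C CE] : (B <= sel R S *m W)%MS by rewrite BW.
have volC : vol C * vol (sel R S *m W) = 1 by apply: (vol_coord rF); rewrite -CE.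
have volC0 : vol C != 0.
  apply: contra_eqN volC => /eqP ->; rewrite mul0r eq_sym; exact: oner_neq0.
have -> : vol (sel R S *m W) = (vol C)^-1.
  by apply: (mulfI volC0); rewrite divff.
pose g (s : 'rV[R]_(\rank F)) : \bar R := (box predT (s *m C))%:E.
have bg : borel g by exact: (borel_linear C (@borel_box R _ predT)).
set A := (X in fine (_ X)).
have AE : A = (g \o @row_of_tuple R (\rank F)) @^-1` [set 1%E].
  apply/funext => t; apply/propext; rewrite /A /g /=.
  set s := row_of_tuple t.
  have -> : (box predT (s *m C))%:E = 1%E <-> (forall i, 0 <= (s *m C) 0 i <= 1).
    rewrite boxTE; split => [[]|h].
      by case: forallP => // _ /eqP; rewrite eq_sym oner_eq0.
    by rewrite (introT forallP h).
  rewrite CE mulmxA; split => [[c [c01]]|sC01].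
    rewrite sum_sel => /(row_free_inj (sel_unit_free S uW)) -> i.
    by rewrite mxE.
  (* the coordinates s C, extended by zero outside S *)
  exists (fun k => (s *m C *m sel R S) 0 k).
  have sCE i : (s *m C *m sel R S) 0 (enum_val i) = (s *m C) 0 i.
    by rewrite -mul_sel_tr -mulmxA sel_orthonormal mulmx1.
  split => [k|]; last first.
    rewrite sum_sel; congr (_ *m _); apply/rowP => i; rewrite [RHS]mxE.
    by rewrite sCE.
  have [kS|kS] := boolP (k \in S).
    by rewrite -(enum_rankK_in kS kS) sCE.
  have kS' : k \in (~: S)%SET by rewrite inE.
  rewrite -(enum_rankK_in kS' kS') -mul_sel_tr -(mulmxA _ (sel R S)) sel_disjoint mulmx0.
  by rewrite mxE lexx ler01.
have mA : measurable A.
  rewrite AE -[X in measurable X]setTI; apply: bg => //; exact: emeasurable_set1.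
rewrite -[X in fine (_ X)]setIT -integral_indic//.
rewrite (_ : integral _ _ _ = row_integral g); last first.
  apply: eq_integral => t _; rewrite indicE AE /g /= boxTE.
  case: forallP => h; congr (_%:E).
    by rewrite mem_set//= boxTE (introT forallP h).
  rewrite memNset//= boxTE (introF forallP h) => -[/eqP].
  by rewrite eq_sym oner_eq0.
rewrite (@eq_row_integral _ _ _ (fun v => (box predT (v *m (C^T)^T))%:E)); last first.
  by move=> v; rewrite /g trmxK.
have rFC : #|S| = \rank F by rewrite rF.
rewrite (@row_integral_vol _ _ _ C^T (fun v => (box predT v)%:E))//.
- by rewrite row_integral_box mule1 vol_tr.
- by rewrite vol_tr.
- exact: borel_box.
- by move=> v; rewrite lee_fin box_ge0.
Qed.

End fibers.

(** * Borel measurability of closed sets *)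

Section topology.
Context (R : realType).
Local Notation mR := (measurableTypeR R).

Lemma continuous_mulmx n k (A : 'M[R]_(n, k)) :
  continuous (fun x : 'rV[R]_n => x *m A).
Proof.
have cs i (s : seq 'I_n) : continuous (fun x : 'rV[R]_n => \sum_(j <- s) x 0 j * A j i).
  elim: s => [|j s IH].
    rewrite (_ : (fun _ => _) = cst 0); first exact: cst_continuous.
    by apply/funext => x; rewrite big_nil.
  rewrite (_ : (fun _ => _) =
      (fun x : 'rV[R]_n => x 0 j * A j i) \+ (fun x => \sum_(j <- s) x 0 j * A j i)).
    move=> x; apply: continuousD; last exact: IH.
    apply: continuousM; last exact: cst_continuous.
    exact: coord_continuous.
  by apply/funext => x; rewrite big_cons.
move=> x B /nbhs_ballP[e e0 eB].
have FF : Filter (nbhs x) := nbhs_filter x.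
have : \forall y \near x, forall i : 'I_k, ball ((x *m A) 0 i) e ((y *m A) 0 i).
  apply: (@filter_forall _ _ _ (nbhs x) FF) => i.
  have /(_ _ (nbhsx_ballx _ e e0)) := cs i (index_enum _) x.
  by rewrite /= /nbhs /=; apply: filterS => y; rewrite /= !mxE.
apply: filterS => y xy; apply: eB; split=> // i j; rewrite (ord1 i); exact: xy.
Qed.

Lemma measurable_cube n (q : 'rV[R]_n) (r : R) :
  measurable [set t : n.-tuple mR | forall i, `|tnth t i - q 0 i| < r].
Proof.
rewrite (_ : [set _ | _] = \bigcap_(i in [set: 'I_n])
    ((fun t : n.-tuple mR => tnth t i) @^-1` `]q 0 i - r, q 0 i + r[%classic)); last first.
  apply/seteqP; split=> t /= h i; first by move=> _; rewrite /= in_itv /= -ltr_distl; exact: h.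
  by have := h i I; rewrite /= in_itv/= -ltr_distl.
apply: fin_bigcap_measurable => // i _.
by rewrite -[X in measurable X]setTI; apply: measurable_tnth => //; exact: measurable_itv.
Qed.

(** A closed set is the intersection over k of the union of those cubes of
    radius 1/(k+1), centred at rational points, that meet it. *)
Lemma measurable_closed_preimage n (A : set 'rV[R]_n) : closed A ->
  measurable (@row_of_tuple R n @^-1` A).
Proof.
move=> cA.
pose ratv (q : 'rV[rat]_n) : 'rV[R]_n := map_mx ratr q.
pose near_A k (q : 'rV[rat]_n) := exists2 a, A a & forall i, `|a 0 i - ratv q 0 i| < k.+1%:R^-1.
pose cube k (q : 'rV[rat]_n) :=
  [set t : n.-tuple mR | forall i, `|tnth t i - ratv q 0 i| < k.+1%:R^-1].
rewrite (_ : _ @^-1` _ = \bigcap_k \bigcup_q (if `[< near_A k q >] then cube k q else set0)).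
  apply: bigcap_measurableType => k _; apply: countable_bigcupT_measurable => // q.
  by case: ifP => // _; exact: measurable_cube.
apply/seteqP; split => t /=.
  move=> At k _.
  have /choice[q qP] i : exists q : rat, `|tnth t i - ratr q| < k.+1%:R^-1.
    have /rat_in_itvoo[q] : tnth t i - k.+1%:R^-1 < tnth t i + k.+1%:R^-1.
      by rewrite ltrD2l gtrN// invr_gt0 ltr0n.
    by rewrite in_itv/= -ltr_distl distrC => qt; exists q.
  exists (\row_i q i) => //.
  rewrite asboolT; first by move=> i; rewrite !mxE.
  by exists (row_of_tuple t) => // i; rewrite !mxE.
move=> h; apply: cA => B /nbhs_ballP[e e0 eB].
have [k] := ltr_add_invr (divr_gt0 e0 (ltr0n R 2)); rewrite add0r => ke.
have [q _] := h k I; case: asboolP => // -[a Aa aq] tq.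
exists a; split=> //; apply: eB; split=> // i j; rewrite (ord1 i).
rewrite /ball /= mxE (le_lt_trans (ler_distD (ratv q 0 j) _ _))//.
rewrite [ltRHS]splitr ltrD// (lt_trans _ ke)// distrC -distrC //.
by rewrite distrC aq.
Qed.

End topology.

(** * Projections of functions *)

Section projections.
Context (R : realType).
Local Notation mR := (measurableTypeR R).

Lemma sub_orthogonal_complement n m (F : 'M[R]_n) (y : 'M[R]_(m, n)) :
  (y <= orthogonal_complement F)%MS = (y *m F^T == 0).
Proof. by rewrite /orthogonal_complement /orthomx sub_kermx mul1mx map_mx_id. Qed.

Lemma orthogonal_eqmx n k m (F : 'M[R]_n) (A : 'M[R]_(k, n)) (y : 'M[R]_(m, n)) :
  (A :=: F)%MS -> (y *m F^T == 0) = (y *m A^T == 0).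
Proof.
move=> AF.
have /submxP[C CE] : (A <= F)%MS by rewrite AF.
have /submxP[D DE] : (F <= A)%MS by rewrite AF.
apply/eqP/eqP => y0.
  by rewrite CE trmx_mul mulmxA y0 mul0mx.
by rewrite DE trmx_mul mulmxA y0 mul0mx.
Qed.

(** A supremum exceeds c if and only if one of its terms is at least
    c + 1/(k+1) for some k, so this criterion fits functions defined as
    suprema, whether or not the suprema are attained. *)
Lemma borel_superlevel n (h : 'rV[R]_n -> \bar R) (K : R -> set 'rV[R]_n) :
  (forall v, 0 <= h v)%E -> (forall c, 0 < c -> closed (K c)) ->
  (forall c v, 0 <= c -> (c%:E < h v)%E <-> exists k, K (c + k.+1%:R^-1) v) ->
  borel h.
Proof.
move=> h0 cK hK; apply: (measurability _ (ErealGenOInfty.measurableE R)).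
move=> _ [_ [c ->] <-]; rewrite setTI.
have [c0|c0] := leP 0 c; last first.
  rewrite (_ : _ @^-1` _ = setT)//.
  apply/seteqP; split=> // t _ /=; rewrite in_itv/= andbT.
  by apply: lt_le_trans (h0 _); rewrite lte_fin.
rewrite (_ : _ @^-1` _ = \bigcup_k (@row_of_tuple R n @^-1` K (c + k.+1%:R^-1))).
  apply: bigcup_measurable => k _; apply: measurable_closed_preimage.
  by apply: cK; rewrite ltr_wpDl// invr_gt0 ltr0n.
apply/seteqP; split=> t /=; rewrite in_itv/= andbT.
  by move/(hK _ _ c0) => [k Kt]; exists k.
by move=> [k _ Kt]; apply/(hK _ _ c0); exists k.
Qed.

(** Since c > 0, the superlevel set lies in the support, where f is
    continuous. *)
Lemma compact_superlevel n (f : 'rV[R]_n -> R) (c : R) :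
  compact (support_set f) -> {within support_set f, continuous f} -> 0 < c ->
  compact [set x | c <= `|f x|].
Proof.
move=> cS cf c0.
have clS : closed (support_set f) by exact: closed_closure.
have sub : [set x | c <= `|f x|] `<=` support_set f.
  move=> x /= cx; apply: subset_closure => /=.
  by rewrite -normr_gt0 (lt_le_trans c0).
have /continuous_closedP/(_ [set r | c <= `|r|]) := cf.
have cc : closed [set r : R | c <= `|r|].
  rewrite (_ : [set _ | _] = Num.norm @^-1` [set r | c <= r])//.
  by apply: closed_comp; [move=> x _; exact: norm_continuous|exact: closed_ge].
move=> /(_ cc)/closed_subspaceP[V cV VE].
apply: (subclosed_compact _ cS sub).
have -> : [set x | c <= `|f x|] = V `&` support_set f.
  by rewrite VE; apply/seteqP; split=> [x /= fx|x [] //]; split=> //; exact: sub.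
exact: closedI.
Qed.

Section project.
Context k n (B : 'M[R]_(k, n)) (F : 'M[R]_n) (g : 'rV[R]_n -> R).
Hypotheses (B1 : B *m B^T = 1%:M) (BF : (B :=: F)%MS).

(** The matrix B^T B is the orthogonal projection onto F. *)
Lemma residue_orthogonal (x : 'rV[R]_n) :
  (x - x *m B^T *m B <= orthogonal_complement F)%MS.
Proof.
rewrite sub_orthogonal_complement (orthogonal_eqmx _ BF).
by rewrite mulmxBl -(mulmxA _ B) B1 mulmx1 subrr.
Qed.

Lemma le_projection (x : 'rV[R]_n) :
  ((g x)%:E <= projection F g (x *m B^T *m B))%E.
Proof.
apply: ereal_sup_ubound; exists (x - x *m B^T *m B); first exact: residue_orthogonal.
by rewrite addrC subrK.
Qed.

Lemma projection_ge0 (x : 'rV[R]_n) : (forall v, 0 <= g v) ->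
  (0 <= projection F g x)%E.
Proof.
move=> g0; apply: (@le_trans _ _ (g (x + 0))%:E); first by rewrite lee_fin.
by apply: ereal_sup_ubound; exists 0 => //=; rewrite sub0mx.
Qed.

(** The projected function exceeds c at s exactly when s is the projection of a
    point where g exceeds c, and the projection of a compact set is compact. *)
Lemma borel_projection : (forall v, 0 <= g v) ->
  (forall c, 0 < c -> compact [set x | c <= g x]) ->
  borel (fun s => projection F g (s *m B)).
Proof.
move=> g0 cg.
apply: (@borel_superlevel _ _ (fun c => (fun x => x *m B^T) @` [set x | c <= g x])).
- by move=> v; exact: projection_ge0.
- move=> c c0; apply: compact_closed; first exact: norm_hausdorff.
  apply: continuous_compact; last exact: cg.
  exact/continuous_subspaceT/continuous_mulmx.
move=> c s c0; split.
  move=> /ereal_sup_gt[_ [y /= yF <-]]; rewrite lte_fin => cy.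
  have [j cj] := ltr_add_invr cy.
  exists j, (s *m B + y); first exact: ltW.
  move: yF; rewrite sub_orthogonal_complement (orthogonal_eqmx _ BF) => /eqP yB.
  by rewrite mulmxDl -mulmxA B1 mulmx1 yB addr0.
move=> [j [x /= cx xs]]; rewrite -xs; apply: lt_le_trans (le_projection x).
by rewrite lte_fin (lt_le_trans _ cx)// ltrDl invr_gt0 ltr0n.
Qed.

End project.
End projections.

(** * Orthogonal complements and dual bases *)

Section dual_volume.
Context (R : realType).

(** The rows of the transposed inverse are the dual basis. A vector orthogonal
    to the w_k with k outside S has vanishing coordinates there in this basis. *)
Lemma orthogonal_span n (W : 'M[R]_n) (S : {set 'I_n}) (F : 'M[R]_n) :
  W \in unitmx -> (F :=: sel R (~: S) *m W)%MS ->
  (orthogonal_complement F :=: sel R S *m (invmx W)^T)%MS.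
Proof.
move=> uW FE; apply/eqmxP/andP; split; last first.
  rewrite sub_orthogonal_complement (orthogonal_eqmx _ (eqmx_sym FE)).
  rewrite trmx_mul mulmxA -(mulmxA (sel R S)) -trmx_mul mulmxV// trmx1 mulmx1.
  by rewrite sel_disjoint.
set C := orthogonal_complement F.
have : (C <= orthogonal_complement F)%MS by [].
rewrite sub_orthogonal_complement (orthogonal_eqmx _ (eqmx_sym FE)) => /eqP C0.
have -> : C = C *m W^T *m (sel R S)^T *m (sel R S *m (invmx W)^T).
  rewrite mulmxA -(mulmxA _ _ (sel R S)).
  rewrite -[X in X *m _](addrK (C *m W^T *m ((sel R (~: S))^T *m sel R (~: S)))).
  rewrite -mulmxDr sel_complete mulmx1 (mulmxA _ (sel R (~: S))^T) -(mulmxA C).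
  rewrite -trmx_mul C0 mul0mx subr0 -mulmxA -trmx_mul mulVmx// trmx1 mulmx1.
  by [].
exact: submxMl.
Qed.

(** Jacobi's identity for complementary minors, applied to the Gram matrix
    G = W W^T and its inverse K, the Gram matrix of the dual basis. Multiplying G,
    in block form along S and its complement, by the block column of K for S
    completed by (0, 1) gives an upper block triangular matrix; now take
    determinants. *)
Lemma vol_dual n (W : 'M[R]_n) (S : {set 'I_n}) : W \in unitmx ->
  vol (sel R S *m (invmx W)^T) * `|\det W| = vol (sel R (~: S) *m W).
Proof.
move=> uW; pose G := W *m W^T; pose K := (invmx W)^T *m invmx W.
have GK : G *m K = 1%:M.
  by rewrite /G /K mulmxA -(mulmxA W) -trmx_mul mulVmx// trmx1 mulmx1 mulmxV.
pose e := sel R S; pose e' := sel R (~: S).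
pose P := col_mx e e'.
have PP : P *m P^T = 1%:M.
  rewrite tr_col_mx mul_col_row !sel_orthonormal sel_disjoint sel_disjointC.
  by rewrite -scalar_mx_block.
have PtP : P^T *m P = 1%:M by rewrite tr_col_mx mul_row_col sel_complete.
have dim : (#|S| + #|~: S|)%N = n by rewrite cardsC card_ord.
have detPG : \det (P *m G *m P^T) = \det G by rewrite det_congruence// PP det1 mul1r.
have PGE : P *m G *m P^T = block_mx (e *m G *m e^T) (e *m G *m e'^T)
    (e' *m G *m e^T) (e' *m G *m e'^T).
  by rewrite mul_col_mx tr_col_mx mul_col_row.
have key q (a : 'M[R]_(q, n)) : a *m G *m e^T *m (e *m K *m e^T) +
    a *m G *m e'^T *m (e' *m K *m e^T) = a *m e^T.
  have -> : a *m G *m e^T *m (e *m K *m e^T) = a *m G *m (e^T *m e) *m (K *m e^T).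
    by rewrite !mulmxA.
  have -> : a *m G *m e'^T *m (e' *m K *m e^T) = a *m G *m (e'^T *m e') *m (K *m e^T).
    by rewrite !mulmxA.
  rewrite -mulmxDl -mulmxDr sel_complete mulmx1 mulmxA -(mulmxA a) GK.
  by rewrite mulmx1.
have /(congr1 determinant) : P *m G *m P^T *m block_mx (e *m K *m e^T) 0 (e' *m K *m e^T) 1%:M =
    block_mx 1%:M (e *m G *m e'^T) 0 (e' *m G *m e'^T).
  rewrite PGE mulmx_block !mulmx1 !mulmx0 !add0r !key.
  by rewrite sel_orthonormal sel_disjointC.
rewrite det_mulmx detPG det_lblock det_ublock !det1 mul1r mulr1 => detE.
have KE : e *m (invmx W)^T *m (e *m (invmx W)^T)^T = e *m K *m e^T.
  by rewrite trmx_mul trmxK !mulmxA.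
have GE : e' *m W *m (e' *m W)^T = e' *m G *m e'^T.
  by rewrite trmx_mul !mulmxA.
rewrite -vol_square mulrC /vol -sqrtrM ?det_gram_ge0//.
by rewrite KE GE -detE.
Qed.
End dual_volume.

(** * The inequality for the rows of an invertible matrix *)

Section core.
Context (R : realType).
Local Notation mR := (measurableTypeR R).

Lemma poweR_sum m (p : 'I_m -> R) (x : \bar R) : (0 < m)%N -> (0 <= x)%E ->
  (forall j, 0 < p j) ->
  (\big[*%E/1]_j (x `^ p j) = x `^ (\sum_j p j)%R)%E.
Proof.
move=> m0 x0 p0; have [->|xn0] := eqVneq x 0%E.
  have sp : 0 < \sum_j p j.
    rewrite (bigD1 (Ordinal m0))//= ltr_pwDl// sumr_ge0// => j _; exact: ltW.
  by rewrite (@prode_eq0 _ _ _ _ (Ordinal m0))// poweR0r// gt_eqF.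
suff [] : (\big[*%E/1]_j (x `^ p j) = x `^ (\sum_j p j)%R)%E /\ 0 <= \sum_j p j by [].
elim: (index_enum _) => [|j s [IH s0]]; first by rewrite !big_nil poweRe0 lexx.
rewrite !big_cons addr_ge0 ?(ltW (p0 _))// IH poweRD//.
by apply: nneg_neq0_poweRD_def => //; exact: ltW.
Qed.

Lemma prode_poweR m (y : 'I_m -> \bar R) (r : R) : (forall j, 0 <= y j)%E ->
  ((\big[*%E/1]_j y j) `^ r = \big[*%E/1]_j (y j `^ r))%E.
Proof.
move=> y0; suff [] : ((\big[*%E/1]_j y j) `^ r = \big[*%E/1]_j (y j `^ r))%E /\
   (0 <= \big[*%E/1]_j y j)%E by [].
elim: (index_enum _) => [|j s [IH s0]]; first by rewrite !big_nil poweR1r.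
by rewrite !big_cons poweRM// IH mule_ge0.
Qed.

Lemma le_prode m (a b : 'I_m -> \bar R) : (forall j, 0 <= a j)%E ->
  (forall j, a j <= b j)%E -> (\big[*%E/1]_j a j <= \big[*%E/1]_j b j)%E.
Proof.
move=> a0 ab; suff [] : (\big[*%E/1]_j a j <= \big[*%E/1]_j b j)%E /\
   (0 <= \big[*%E/1]_j a j)%E by [].
elim: (index_enum _) => [|j s [IH s0]]; first by rewrite !big_nil lexx.
by rewrite !big_cons mule_ge0// lee_pmul.
Qed.

Lemma subspace_norm1E n (F : 'M[R]_n) (h : 'rV[R]_n -> \bar R) :
  (forall x, 0 <= h x)%E ->
  subspace_norm1 F h = row_integral (fun s => h (s *m orthonormal_basis F)).
Proof.
move=> h0; rewrite /subspace_norm1 Lnorm1; apply: eq_integral => t _.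
by rewrite /= gee0_abs.
Qed.

Lemma Lq_normE n (q : R) (f : 'rV[R]_n -> R) :
  Lq_norm q%:E f = ((row_integral (fun x => `|f x|%:E `^ q)) `^ q^-1)%E.
Proof. by rewrite /Lq_norm unlock. Qed.

Section inequality.
Context n m (W : 'M[R]_n) (S : 'I_m -> {set 'I_n}) (p : 'I_m -> R)
  (F : 'I_m -> 'M[R]_n) (f : 'rV[R]_n -> R).
Hypotheses (uW : W \in unitmx) (cover : uniform_cover S p)
  (FW : forall j, (F j :=: sel R (S j) *m W)%MS)
  (f_compact : compact (support_set f))
  (f_cont : {within support_set f, continuous f}).

Let absf x := `|f x|.
Let N j := subspace_norm1 (F j) (projection (F j) absf).
Let B j := orthonormal_basis (F j).
Let h j s := projection (F j) absf (s *m B j).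

Let B1 j : B j *m (B j)^T = 1%:M.
Proof. by rewrite /B /orthonormal_basis; case: cid => ? []. Qed.

Let BF j : (B j :=: F j)%MS.
Proof. by rewrite /B /orthonormal_basis; case: cid => ? []. Qed.

Let BW j : (B j :=: sel R (S j) *m W)%MS.
Proof. exact: eqmx_trans (BF j) (FW j). Qed.

Let f_superlevel c : 0 < c -> compact [set x | c <= absf x].
Proof. exact: compact_superlevel. Qed.

Let absf_ge0 x : 0 <= absf x. Proof. exact: normr_ge0. Qed.

Let bh j : borel (@h j).
Proof. exact: borel_projection. Qed.

Let h0 j s : (0 <= @h j s)%E.
Proof. exact: projection_ge0. Qed.

Lemma borel_absf : borel (fun x => (absf x)%:E).
Proof.
apply: (@borel_superlevel _ _ _ (fun c => [set x | c <= absf x])).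
- by move=> v; rewrite lee_fin.
- by move=> c c0; apply: compact_closed; [exact: norm_hausdorff|exact: f_superlevel].
move=> c v c0; rewrite lte_fin; split=> [/ltr_add_invr[k ck]|[k]]; first by exists k; exact: ltW.
by apply: lt_le_trans; rewrite ltrDl invr_gt0 ltr0n.
Qed.

(** The coordinates of the projection onto F_j depend on y only through its
    restriction to S_j. *)
Let coord_indep j (u v : 'rV[R]_n) : (forall i, i \in S j -> u 0 i = v 0 i) ->
  u *m (invmx W)^T *m (B j)^T = v *m (invmx W)^T *m (B j)^T.
Proof.
have /submxP[C ->] : (B j <= sel R (S j) *m W)%MS by rewrite BW.
move=> uv; rewrite mulmxA [(_ *m W)^T]trmx_mul !mulmxA -!(mulmxA _ _ W^T).
rewrite -trmx_mul mulmxV// trmx1 !mulmx1 trmx_mul !mulmxA; congr (_ *m _).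
by apply/rowP => i; rewrite !mul_sel_tr; apply: uv; exact: enum_valP.
Qed.

(** Finner's inequality in the coordinates y = x W^T, which are the inner
    products with the rows of W. *)
Lemma integral_power_le :
  (row_integral (fun x => (absf x)%:E `^ (\sum_j p j)%R) <=
   (`|\det W|^-1)%:E *
     \big[*%E/1]_j ((vol (sel R (S j) *m W))%:E * N j) `^ p j)%E.
Proof.
have [m0 p0 cov] := cover.
pose Phi x := (\big[*%E/1]_j (@h j (x *m (B j)^T) `^ p j))%E.
have bPhi : borel Phi.
  by apply: borel_prod => j; apply: borel_poweR; exact: borel_linear.
have Phi0 x : (0 <= Phi x)%E by apply: prode_ge0 => j _; exact: poweR_ge0.
apply: (@le_trans _ _ (row_integral Phi)).
  apply: le_row_integral => //.
  - by apply: borel_poweR; exact: borel_absf.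
  - by move=> v; exact: poweR_ge0.
  - move=> x; rewrite -poweR_sum//; last by rewrite lee_fin.
    apply: le_prode => j; first exact: poweR_ge0.
    apply: gt0_ler_poweR; rewrite ?(ltW (p0 j))// ?in_itv/= ?leey ?andbT ?lee_fin//.
    exact: (le_projection absf (B1 j) (BF j) x).
have -> : (row_integral Phi = `|\det W|^-1%:E *
   row_integral (fun y => Phi (y *m (invmx W)^T)))%E.
  rewrite (@row_integral_linear _ _ (invmx W)^T) ?unitmx_tr ?unitmx_inv//.
  rewrite det_tr det_inv normfV invrK muleA -EFinM mulVf ?mul1e//.
  by rewrite normr_eq0 -unitfE -unitmxE.
apply: lee_wpmul2l; first by rewrite lee_fin invr_ge0.
have NE j : ((vol (sel R (S j) *m W))%:E * N j =
    row_integral (fun y => @h j (y *m (invmx W)^T *m (B j)^T) *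
      (box (predC (mem (S j))) y)%:E))%E.
  rewrite (row_integral_fiber (B1 j) uW (BW j) (@bh j) (@h0 j)).
  rewrite /N subspace_norm1E//.
  by move=> x; exact: projection_ge0.
under eq_bigr do rewrite NE.
apply: (@finner _ _ _ p (fun j => mem (S j))
  (fun j y => @h j (y *m (invmx W)^T *m (B j)^T))) => //.
- move=> j; under eq_fun do rewrite -mulmxA.
  exact: borel_linear.
- by move=> j u v uv; rewrite (coord_indep uv).
Qed.

Theorem Lq_norm_le :
  (Lq_norm (\sum_j p j)%:E f <=
   (((\prod_j vol (sel R (S j) *m W) `^ p j) / `|\det W|) `^ (\sum_j p j)^-1)%:E *
   \big[*%E/1]_j (N j `^ (p j / \sum_j p j)))%E.
Proof.
have [m0 p0 _] := cover; set q := \sum_j p j.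
have q0 : 0 < q.
  rewrite /q (bigD1 (Ordinal m0))//= ltr_pwDl// sumr_ge0// => j _; exact: ltW.
have N0 j : (0 <= N j)%E by exact: Lnorm_ge0.
have v0 j : 0 <= vol (sel R (S j) *m W) by exact: sqrtr_ge0.
have vN0 j : (0 <= ((vol (sel R (S j) *m W))%:E * N j) `^ p j)%E by exact: poweR_ge0.
have d0 : 0 <= `|\det W|^-1 by rewrite invr_ge0.
have P0 : 0 <= \prod_j vol (sel R (S j) *m W) `^ p j.
  by apply: prodr_ge0 => j _; exact: powR_ge0.
rewrite Lq_normE.
apply: (@le_trans _ _ (((`|\det W|^-1)%:E *
     \big[*%E/1]_j ((vol (sel R (S j) *m W))%:E * N j) `^ p j) `^ q^-1)%E).
  apply: gt0_ler_poweR; rewrite ?invr_ge0 ?(ltW q0)//.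
  - by rewrite in_itv/= leey andbT; apply: row_integral_ge0 => x; rewrite lee_fin powR_ge0.
  - by rewrite in_itv/= leey andbT mule_ge0// prode_ge0.
  - exact: integral_power_le.
have X0 : (0 <= \big[*%E/1]_j (N j `^ p j))%E.
  by apply: prode_ge0 => j _; exact: poweR_ge0.
have -> : (\big[*%E/1]_j ((vol (sel R (S j) *m W))%:E * N j) `^ p j =
    (\prod_j vol (sel R (S j) *m W) `^ p j)%:E * \big[*%E/1]_j (N j `^ p j))%E.
  rewrite -prodEFin -big_split/=; apply: eq_bigr => j _.
  by rewrite poweRM// lee_fin.
have -> : (\big[*%E/1]_j (N j `^ (p j / q)) = (\big[*%E/1]_j (N j `^ p j)) `^ q^-1)%E.
  rewrite prode_poweR; last by move=> j; exact: poweR_ge0.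
  by apply: eq_bigr => j _; rewrite poweRrM.
by rewrite muleA -EFinM mulrC poweRM// lee_fin mulr_ge0.
Qed.

End inequality.
End core.

(** * The two covers and the two bases *)

Section brascamp_lieb.
Context (R : realType).
Local Notation mR := (measurableTypeR R).

Lemma vol_row0 k n (A : 'M[R]_(k, n)) : k = 0%N -> vol A = 1.
Proof. by move=> k0; subst k; rewrite /vol det_mx00 sqrtr1. Qed.

Lemma vol_setT n (W : 'M[R]_n) : W \in unitmx ->
  vol (sel R [set: 'I_n]%SET *m W) = `|\det W|.
Proof.
move=> uW; (* empty families have volume 1, so that the dual family of the empty set
   computes the volume of the whole basis *)
rewrite -finset.setC0 -vol_dual// vol_row0 ?mul1r//; exact: cards0.
Qed.

Lemma prod_powR m (y : 'I_m -> R) (r : R) : (forall j, 0 <= y j) ->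
  (\prod_j y j) `^ r = \prod_j y j `^ r.
Proof.
move=> y0; suff [] : (\prod_j y j) `^ r = \prod_j y j `^ r /\ 0 <= \prod_j y j by [].
elim: (index_enum _) => [|j s [IH s0]]; first by rewrite !big_nil powR1 ler01.
by rewrite !big_cons powRM// IH mulr_ge0.
Qed.

Lemma prod_powR_sum m (p : 'I_m -> R) (d : R) : d != 0 ->
  \prod_j d `^ p j = d `^ (\sum_j p j).
Proof.
move=> d0; elim: (index_enum _) => [|j s IH]; first by rewrite !big_nil powRr0.
by rewrite !big_cons IH powRD// d0 implybT.
Qed.

Lemma powRV (d r : R) : 0 <= d -> d^-1 `^ r = (d `^ r)^-1.
Proof. by move=> d0; rewrite -powR_inv1// -powRrM mulN1r powRN. Qed.

Lemma wedge_norm_ge0 n (w : 'I_n -> 'rV[R]_n) (T : {set 'I_n}) :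
  basis_of fullv [seq w i | i : 'I_n] -> 0 <= wedge_norm w T.
Proof. by move=> /basis_unitmx uW; rewrite wedge_normE// sqrtr_ge0. Qed.

Lemma wedge_norm_gt0 n (w : 'I_n -> 'rV[R]_n) :
  basis_of fullv [seq w i | i : 'I_n] -> 0 < wedge_norm w [set: 'I_n]%SET.
Proof.
move=> /basis_unitmx uW; rewrite wedge_normE// vol_setT//.
by rewrite normr_gt0 -unitfE -unitmxE.
Qed.

Lemma Lq_norm_le_span n m (w : 'I_n -> 'rV[R]_n) (S : 'I_m -> {set 'I_n})
    (p : 'I_m -> R) (f : 'rV[R]_n -> R) :
  basis_of fullv [seq w i | i : 'I_n] -> uniform_cover S p ->
  compact (support_set f) -> {within support_set f, continuous f} ->
  (Lq_norm (\sum_j p j)%:E f <=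
   (BL2 w S p `^ (\sum_j p j)^-1)%:E *
   \big[*%E/1]_j
    subspace_norm1 (lin_span w (S j))
      (projection (lin_span w (S j)) (fun x => `|f x|%R)) `^ (p j / \sum_j p j))%E.
Proof.
move=> /basis_unitmx uW cov cf ctf.
have -> : BL2 w S p = (\prod_j vol (sel R (S j) *m \matrix_i w i) `^ p j) /
    `|\det (\matrix_i w i)|.
  rewrite /BL2 wedge_normE// vol_setT//; congr (_ / _).
  by apply: eq_bigr => j _; rewrite wedge_normE.
by apply: Lq_norm_le => // j; exact: lin_spanE.
Qed.

(** The dual basis is used here: it turns orthogonal complements into spans. *)
Lemma Lq_norm_le_orthogonal n m (w : 'I_n -> 'rV[R]_n) (S : 'I_m -> {set 'I_n})
    (p : 'I_m -> R) (f : 'rV[R]_n -> R) :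
  basis_of fullv [seq w i | i : 'I_n] -> uniform_cover S p ->
  compact (support_set f) -> {within support_set f, continuous f} ->
  let F j := orthogonal_complement (lin_span w (~: S j)%SET) in
  (Lq_norm (\sum_j p j)%:E f <=
   (BL1 w S p `^ (\sum_j p j)^-1)%:E *
   \big[*%E/1]_j
    subspace_norm1 (F j) (projection (F j) (fun x => `|f x|%R)) `^ (p j / \sum_j p j))%E.
Proof.
move=> /basis_unitmx uW cov cf ctf; cbv zeta.
pose W := \matrix_i w i; pose W' := (invmx W)^T.
have uW' : W' \in unitmx by rewrite unitmx_tr unitmx_inv.
have d0 : 0 < `|\det W| by rewrite normr_gt0 -unitfE -unitmxE.
have -> : BL1 w S p = (\prod_j vol (sel R (S j) *m W') `^ p j) / `|\det W'|.
  rewrite /BL1 wedge_normE// vol_setT// -/W det_tr det_inv normfV invrK.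
  rewrite (eq_bigr (fun j => vol (sel R (S j) *m W') `^ p j * `|\det W| `^ p j)).
    rewrite big_split/= prod_powR_sum ?gt_eqF// -mulrA; congr (_ * _).
    rewrite -powRB; last by rewrite (gt_eqF d0) implybT.
    by rewrite subKr powRr1// ltW.
  by move=> j _; rewrite wedge_normE// -vol_dual// powRM// sqrtr_ge0.
apply: Lq_norm_le => // j; apply: orthogonal_span => //; exact: lin_spanE.
Qed.

(** Each point i is covered by the complements with weight p - 1 in total. *)
Lemma uniform_cover_complement n m (S : 'I_m -> {set 'I_n}) (p : 'I_m -> R) :
  uniform_cover S p -> 1 < \sum_j p j ->
  uniform_cover (fun j => ~: S j)%SET (fun j => p j / (\sum_j p j - 1)).
Proof.
move=> [m0 p0 cov] p1; have p10 : 0 < \sum_j p j - 1 by rewrite subr_gt0.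
split=> // [j|i]; first by rewrite divr_gt0.
rewrite (eq_bigr (fun j => (p j - p j * (i \in S j)%:R) / (\sum_j p j - 1))); last first.
  move=> j _; rewrite inE mulrAC; congr (_ / _).
  by case: (i \in S j); rewrite /= ?mulr1 ?mulr0 ?subrr ?subr0.
by rewrite -mulr_suml sumrB cov divff// gt_eqF.
Qed.

Lemma BL1_complement n m (w : 'I_n -> 'rV[R]_n) (S : 'I_m -> {set 'I_n})
    (p : 'I_m -> R) : basis_of fullv [seq w i | i : 'I_n] -> 1 < \sum_j p j ->
  BL1 w (fun j => ~: S j)%SET (fun j => p j / (\sum_j p j - 1)) =
  BL2 w S p `^ (\sum_j p j - 1)^-1.
Proof.
move=> bw p1; rewrite /BL1 /BL2; set q := \sum_j p j in p1 *.
have q1 : q - 1 != 0 by rewrite subr_eq0 gt_eqF.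
have P0 : 0 <= \prod_j wedge_norm w (S j) `^ p j.
  by apply: prodr_ge0 => j _; exact: powR_ge0.
have d0 := wedge_norm_ge0 [set: 'I_n]%SET bw.
rewrite powRM ?invr_ge0// powRV// -mulr_suml -/q prod_powR; last first.
  by move=> j; exact: powR_ge0.
congr (_ / (_ `^ _)); last by field.
by apply: eq_bigr => j _; rewrite finset.setCK powRrM.
Qed.

Lemma BL2_complement n m (w : 'I_n -> 'rV[R]_n) (S : 'I_m -> {set 'I_n})
    (p : 'I_m -> R) : basis_of fullv [seq w i | i : 'I_n] -> 1 < \sum_j p j ->
  BL2 w (fun j => ~: S j)%SET (fun j => p j / (\sum_j p j - 1)) =
  BL1 w S p `^ (\sum_j p j - 1)^-1.
Proof.
move=> bw p1; rewrite /BL1 /BL2; set q := \sum_j p j in p1 *.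
have q1 : q - 1 != 0 by rewrite subr_eq0 gt_eqF.
have P0 : 0 <= \prod_j wedge_norm w (~: S j)%SET `^ p j.
  by apply: prodr_ge0 => j _; exact: powR_ge0.
have d0 := wedge_norm_ge0 [set: 'I_n]%SET bw.
rewrite powRM ?invr_ge0 ?powR_ge0// powRV ?powR_ge0// -[in RHS]powRrM divff// powRr1//.
rewrite prod_powR; last by move=> j; exact: powR_ge0.
by congr (_ / _); apply: eq_bigr => j _; rewrite powRrM.
Qed.

Lemma BL1_full n m (w : 'I_n -> 'rV[R]_n) (S : 'I_m -> {set 'I_n}) (p : 'I_m -> R) :
  basis_of fullv [seq w i | i : 'I_n] -> \sum_j p j = 1 ->
  (forall j, S j = [set: 'I_n]%SET) -> BL1 w S p = 1.
Proof.
move=> bw p1 ST; rewrite /BL1 p1 subrr powRr0 divr1 big1// => j _.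
rewrite ST wedge_normE ?basis_unitmx// vol_row0 ?powR1//.
by rewrite finset.setCT cards0.
Qed.

Lemma BL2_full n m (w : 'I_n -> 'rV[R]_n) (S : 'I_m -> {set 'I_n}) (p : 'I_m -> R) :
  basis_of fullv [seq w i | i : 'I_n] -> \sum_j p j = 1 ->
  (forall j, S j = [set: 'I_n]%SET) -> BL2 w S p = 1.
Proof.
move=> bw p1 ST; have d0 := wedge_norm_gt0 bw; rewrite /BL2.
under eq_bigr do rewrite ST.
by rewrite prod_powR_sum ?gt_eqF// p1 powRr1 ?ltW// divff// gt_eqF.
Qed.

Lemma uniform_cover_ge1 n m (S : 'I_m -> {set 'I_n}) (p : 'I_m -> R) :
  (0 < n)%N -> uniform_cover S p -> 1 <= \sum_j p j.
Proof.
move=> n0 [_ p0 cov]; rewrite -(cov (Ordinal n0)); apply: ler_sum => j _.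
by rewrite ler_piMr ?(ltW (p0 j))// lern1 leq_b1.
Qed.

Lemma uniform_cover_sum1 n m (S : 'I_m -> {set 'I_n}) (p : 'I_m -> R) :
  uniform_cover S p -> \sum_j p j = 1 -> forall j, S j = [set: 'I_n]%SET.
Proof.
move=> [_ p0 cov] p1 j; apply/setP => i; rewrite inE; apply/negPn/negP => iS.
have /eqP : \sum_j p j * (i \notin S j)%:R = 0.
  rewrite (eq_bigr (fun j => p j - p j * (i \in S j)%:R)).
    by rewrite sumrB cov p1 subrr.
  by move=> k _; case: (i \in S k); rewrite /= ?mulr1 ?mulr0 ?subrr ?subr0.
rewrite psumr_eq0; last by move=> k _; rewrite mulr_ge0 ?ler0n ?(ltW (p0 k)).
by move=> /allP/(_ j (mem_index_enum _)); rewrite /= iS mulr1 gt_eqF.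
Qed.

Lemma lebesgue_tuple0 k : k = 0%N -> lebesgue_tuple R k setT = 1%E.
Proof. by move=> k0; subst k; rewrite /= diracT. Qed.

(** The orthogonal complement of the trivial subspace is the whole space, so
    the projection is the constant sup |f| on a one-point space of mass 1. *)
Lemma subspace_norm1_trivial n (G : 'M[R]_n) (f : 'rV[R]_n -> R) :
  \rank G = 0%N ->
  subspace_norm1 G (projection G (fun x => `|f x|%R)) = Lq_norm +oo f.
Proof.
move=> /eqP rG; have /eqP G0 : G == 0 by rewrite -mxrank_eq0.
rewrite /subspace_norm1 Lnorm1 /Lq_norm; set M := ereal_sup _.
have M0 : (0 <= M)%E.
  apply: (@le_trans _ _ `|f 0|%:E); first by rewrite lee_fin.
  by apply: ereal_sup_ubound; exists 0.
have pE x : projection G (fun x => `|f x|%R) x = M.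
  congr ereal_sup; apply/seteqP; split=> _ [y yG <-]; first by exists (x + y).
  exists (y - x); last by rewrite addrC subrK.
  by rewrite /= sub_orthogonal_complement G0 trmx0 mulmx0.
under eq_integral do rewrite /= pE gee0_abs//.
rewrite integral_cst// -[RHS]mule1; congr (_ * _)%E.
by apply: lebesgue_tuple0; exact/eqP.
Qed.

(** If p = 1, the conjugate exponent is infinite, and both sides are the
    supremum of |f|. *)
Lemma conjugate_norm_le_trivial n m (p : 'I_m -> R) (c : R) (G : 'I_m -> 'M[R]_n)
    (f : 'rV[R]_n -> R) :
  (0 < m)%N -> (forall j, 0 < p j) -> \sum_j p j = 1 -> c = 1 ->
  (forall j, \rank (G j) = 0%N) ->
  (Lq_norm (hoelder_conjugate (\sum_j p j)%:E) f <=
    (c `^ (\sum_j p j)^-1)%:E * \big[*%E/1]_j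
      subspace_norm1 (G j) (projection (G j) (fun x => `|f x|%R)) `^ (p j / \sum_j p j))%E.
Proof.
move=> m0 p0 p1 -> rG; rewrite powR1 mul1e p1 hoelder_conjugate1.
under eq_bigr do rewrite subspace_norm1_trivial// divr1.
have M0 : (0 <= Lq_norm +oo f)%E.
  apply: (@le_trans _ _ `|f 0|%:E); first by rewrite lee_fin.
  by apply: ereal_sup_ubound; exists 0.
by rewrite poweR_sum// p1 poweRe1.
Qed.

Lemma hoelder_conjugate_real (q : R) : 1 < q ->
  hoelder_conjugate q%:E = (q / (q - 1))%:E.
Proof.
move=> q1; rewrite /hoelder_conjugate /= eqe gt_eqF ?(lt_trans ltr01)//.
by rewrite inver subr_eq0 gt_eqF// -EFinM.
Qed.

Lemma rank_sel0 n (W : 'M[R]_n) (T : {set 'I_n}) (G : 'M[R]_n) :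
  T = finset.set0 -> (G :=: sel R T *m W)%MS -> \rank G = 0%N.
Proof.
move=> T0 ->; apply/eqP; rewrite -leqn0 (leq_trans (rank_leq_row _))//.
by rewrite T0 cards0.
Qed.

Section conjugate.
Context n m (w : 'I_n -> 'rV[R]_n) (S : 'I_m -> {set 'I_n}) (p : 'I_m -> R)
  (f : 'rV[R]_n -> R).
Hypotheses (n0 : (0 < n)%N) (bw : basis_of fullv [seq w i | i : 'I_n])
  (cov : uniform_cover S p) (cf : compact (support_set f))
  (ctf : {within support_set f, continuous f}).

Let q := \sum_j p j.

Let expE j : 1 < q -> p j / (q - 1) / (q / (q - 1)) = p j / q.
Proof.
move=> q1; have q10 : q - 1 != 0 by rewrite subr_eq0 gt_eqF.
have q0 : q != 0 by rewrite gt_eqF// (lt_trans ltr01).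
by field; rewrite q10 q0.
Qed.

Let constE : 1 < q -> (q - 1)^-1 * (q / (q - 1))^-1 = q^-1.
Proof.
move=> q1; have q10 : q - 1 != 0 by rewrite subr_eq0 gt_eqF.
have q0 : q != 0 by rewrite gt_eqF// (lt_trans ltr01).
by field; rewrite q10 q0.
Qed.

Let sumE : \sum_j p j / (q - 1) = q / (q - 1).
Proof. by rewrite -mulr_suml. Qed.

(** For p > 1, the inequality for spans and the complementary cover. *)
Lemma conjugate_norm_le_span : let F j := lin_span w (~: S j)%SET in
  (Lq_norm (hoelder_conjugate q%:E) f <= (BL1 w S p `^ q^-1)%:E *
    \big[*%E/1]_j subspace_norm1 (F j) (projection (F j) (fun x => `|f x|%R)) `^ (p j / q))%E.
Proof.
have [m0 p0 _] := cov; cbv zeta.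
have := uniform_cover_ge1 n0 cov; rewrite -/q le_eqVlt => /predU1P[/esym q1|q1].
  have ST := uniform_cover_sum1 cov q1.
  apply: conjugate_norm_le_trivial => //; first exact: BL1_full.
  move=> j; apply: (rank_sel0 _ (lin_spanE _ _)).
  by rewrite ST finset.setCT.
have := Lq_norm_le_span bw (uniform_cover_complement cov q1) cf ctf.
rewrite BL2_complement// -/q sumE -powRrM constE// hoelder_conjugate_real//.
by under eq_bigr do rewrite expE//.
Qed.

(** For p > 1, the inequality for orthogonal complements and the complementary
    cover. *)
Lemma conjugate_norm_le_orthogonal :
  let F j := orthogonal_complement (lin_span w (S j)) in
  (Lq_norm (hoelder_conjugate q%:E) f <= (BL2 w S p `^ q^-1)%:E *
    \big[*%E/1]_j subspace_norm1 (F j) (projection (F j) (fun x => `|f x|%R)) `^ (p j / q))%E.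
Proof.
have [m0 p0 _] := cov; cbv zeta.
have := uniform_cover_ge1 n0 cov; rewrite -/q le_eqVlt => /predU1P[/esym q1|q1].
  have ST := uniform_cover_sum1 cov q1.
  apply: conjugate_norm_le_trivial => //; first exact: BL2_full.
  move=> j; apply: (@rank_sel0 _ (invmx (\matrix_i w i))^T finset.set0) => //.
  apply: orthogonal_span; first exact: basis_unitmx.
  by rewrite finset.setC0 -(ST j); exact: lin_spanE.
have := Lq_norm_le_orthogonal bw (uniform_cover_complement cov q1) cf ctf.
cbv zeta.
rewrite BL1_complement// -/q sumE -powRrM constE// hoelder_conjugate_real//.
by under eq_bigr do rewrite expE// finset.setCK.
Qed.
End conjugate.

End brascamp_lieb.

Theorem theorem4p1 (R : realType) (n m : nat) (w : 'I_n -> 'rV[R]_n)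
    (S : 'I_m -> {set 'I_n}) (p : 'I_m -> R) (f : 'rV[R]_n -> R) :
  (0 < n)%N ->
  basis_of fullv [seq w i | i : 'I_n] ->
  uniform_cover S p ->
  compact (support_set f) ->
  {within support_set f, continuous f} ->
  let ptot := \sum_(j < m) p j in
  let H j := lin_span w (S j) in
  let Htilde j := lin_span w (~: S j)%SET in
  let absf x := `|f x| in
  let rhs (c : R) (F : 'I_m -> 'M[R]_n) : \bar R :=
    ((c `^ ptot^-1)%:E * \big[*%E/1]_(j < m)
      subspace_norm1 (F j) (projection (F j) absf) `^ (p j / ptot))%E in
  [/\ (Lq_norm ptot%:E f
        <= rhs (BL1 w S p) (fun j => orthogonal_complement (Htilde j)))%E,
      (Lq_norm (hoelder_conjugate ptot%:E) f
        <= rhs (BL2 w S p) (fun j => orthogonal_complement (H j)))%E,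
      (Lq_norm ptot%:E f <= rhs (BL2 w S p) H)%E &
      (Lq_norm (hoelder_conjugate ptot%:E) f <= rhs (BL1 w S p) Htilde)%E].
Proof.
move=> n0 bw cov cf ctf ptot H Htilde absf rhs; split.
- exact: Lq_norm_le_orthogonal.
- exact: conjugate_norm_le_orthogonal.
- exact: Lq_norm_le_span.
- exact: conjugate_norm_le_span.
Qed.
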